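(* Let $\mathcal{X}$ be a curve of genus $g$ over $\mathbb{F}_q$, let $Q,P_1,\dots,P_n$ be distinct rational points of $\mathcal{X}$ with $n>2g+2$, and let $D=P_1+\dots+P_n$. Let $m$ be a non-negative integer and $i=\dim(C(D,mQ))$. For $r=1,\dots,i$, the $r$-th generalized Hamming weight of $C(D,mQ)$ satisfies $$d_r(C(D,mQ))\ \ge\ d^*_r(i):=\min_{1\le j_1<\dots<j_r\le i}\#\bigl(\Lambda^*_{j_1}\cup\dots\cup\Lambda^*_{j_r}\bigr).$$
   Context: ''Curve'' means projective, non-singular, geometrically irreducible algebraic curve. For a divisor $E$, $\mathcal{L}(E)$ is its Riemann–Roch space. Let $v=-v_Q$, where $v_Q$ is the valuation at $Q$, and $\mathcal{L}(\infty Q)=\bigcup_{r\ge 0}\mathcal{L}(rQ)$. The evaluation map is $ev:\mathcal{L}(\infty Q)\to\mathbb{F}_q^n$, $ev(f)=(f(P_1),\dots,f(P_n))$, and $C(D,mQ)=ev(\mathcal{L}(mQ))$ (so $C(D,-Q)=(0)$). Let $H=H(Q)=\{v(f): f\in\mathcal{L}(\infty Q)\setminus\{0\}\}$ and $H^*=\{m\in\mathbb{N}_0 : C(D,mQ)\neq C(D,(m-1)Q)\}$; $H^*$ has exactly $n$ elements, written $m_1<m_2<\dots<m_n$. For $i=1,\dots,n$ put $\Lambda_i^*=\{m\in H^* : m=m_i+m_j \text{ for some } m_j\in H^*\}$ (equivalently $(m_i+H)\cap H^*$). The support of a set $U\subseteq\mathbb{F}_q^n$ is $\mathrm{supp}(U)=\bigcup_{\mathbf{v}\in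 U}\mathrm{supp}(\mathbf{v})$, where $\mathrm{supp}(\mathbf{v})$ is the set of coordinate positions where $\mathbf{v}$ is non-zero. For a linear code $C$ of dimension $k$ and $1\le r\le k$, the $r$-th generalized Hamming weight is $d_r(C)=\min\{\#\mathrm{supp}(U): U \text{ an } r\text{-dimensional linear subspace of } C\}$. *)

(* Defs.v *)
From HB Require Import structures.
From mathcomp Require Import all_boot all_order all_algebra all_field.
From mathcomp Require Import finmap mpoly.
From mathcomp Require Import boolp classical_sets cardinality.

Set Implicit Arguments.
Unset Strict Implicit.
Unset Printing Implicit Defensive.

Import Order.TTheory GRing.Theory Num.Theory.

Local Open Scope classical_set_scope.
Local Open Scope ring_scope.

(* Varieties over k are described classically, inside projective space over an
   algebraic closure K of k: a curve is given by its homogeneous prime ideal in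
   K[x_0, ..., x_N], which is required to be generated by forms over k, and
   points are given by homogeneous coordinates. *)

(* junk value 0 when A is empty *)
Definition min_nat (A : set nat) : nat :=
  xget 0%N [set a | A a /\ forall b, A b -> (a <= b)%N].

(* The library's quotient by a prime ideal has no idomainType instance, which
   {fraction _} needs, for lack of a computable inverse on its units. *)
Section PrimeQuotient.
Variables (R : comNzRingType) (I : prime_idealr R).

Definition prime_quot := {ideal_quot I}.
HB.instance Definition _ := GRing.ComNzRing.on prime_quot.

Definition prime_quot_unit (x : prime_quot) : bool := `[< exists y, y * x = 1 >].

Definition prime_quot_inv (x : prime_quot) : prime_quot :=
  xget x [set y | y * x = 1].

Fact prime_quot_mulVx :
  {in prime_quot_unit, left_inverse 1 prime_quot_inv *%R}.
Proof.
move=> x /asboolP [y yx].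
exact: (@xgetI _ x [set y | y * x = 1] y yx).
Qed.

Fact prime_quot_unitPl x y : y * x = 1 -> prime_quot_unit x.
Proof. by move=> yx; apply/asboolP; exists y. Qed.

Fact prime_quot_invx_out : {in [predC prime_quot_unit], prime_quot_inv =1 id}.
Proof.
move=> x /negP xU; apply: xgetPN => y yx; apply: xU.
exact: prime_quot_unitPl yx.
Qed.

HB.instance Definition _ := GRing.ComNzRing_hasMulInverse.Build prime_quot
  prime_quot_mulVx prime_quot_unitPl prime_quot_invx_out.

HB.instance Definition _ := GRing.ComUnitRing_isIntegral.Build prime_quot
  (@Quotient.rquot_IdomainAxiom R I).

Definition quot_class (a : R) : prime_quot := (\pi_({ideal_quot I}) a)%qT.

End PrimeQuotient.

Section Projective.
Variables (K : closedFieldType) (N : nat).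
Implicit Types (I : {pred {mpoly K[N.+1]}}) (p : 'I_N.+1 -> K).

Definition same_point (F : fieldType) (p p' : 'I_N.+1 -> F) : Prop :=
  exists2 c : F, c != 0 & forall i, p' i = c * p i.

Definition zero_locus I : set ('I_N.+1 -> K) :=
  [set p | (exists i, p i != 0) /\ forall f, f \in I -> f.@[p] = 0].

(* h = dim_K (S / I)_d, where S = K[x_0, ..., x_N]: the forms B_i of degree d
   are a basis of S_d modulo I *)
Definition hilbert_function I (d h : nat) : Prop :=
  exists2 B : 'I_h -> {mpoly K[N.+1]},
    (forall i, B i \is d.-homog) &
    forall f, f \is d.-homog ->
      exists! c : 'rV[K]_h, f - \sum_i c 0 i *: B i \in I.

Definition hilbert_polynomial I (H : {poly rat}) : Prop :=
  exists d0 : nat, forall d, (d0 <= d)%N ->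
    exists2 h : nat, hilbert_function I d h & H.[d%:R] = h%:R.

End Projective.

(* A prime ideal over the algebraically closed field K is the vanishing ideal
   of its zero locus, so primality of [ideal] is geometric irreducibility.
   The dimension is the degree of the Hilbert polynomial, and non-singularity
   is the Jacobian criterion at every geometric point. *)
Record curve (k : fieldType) (K : closedFieldType) (toK : {rmorphism k -> K}) :=
  Curve {
    ambient_dim : nat;
    ideal : prime_idealr {mpoly K[ambient_dim.+1]};
    nb_eqns : nat;
    eqn : 'I_nb_eqns -> {mpoly k[ambient_dim.+1]};
    eqn_homog : forall s, exists d : nat, eqn s \is d.-homog;
    idealP : forall f, f \in ideal <->
      exists c : 'I_nb_eqns -> {mpoly K[ambient_dim.+1]},
        f = \sum_s c s * map_mpoly toK (eqn s);
    dim1 : exists2 H : {poly rat}, hilbert_polynomial ideal H & size H = 2%N;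
    nonsingular : forall p, zero_locus ideal p ->
      \rank (\matrix_(s < nb_eqns, j < ambient_dim.+1)
               ((map_mpoly toK (eqn s))^`M(j)).@[p]) = (ambient_dim - 1)%N
  }.

Section Curve.
Variables (k : finFieldType) (K : closedFieldType) (toK : {rmorphism k -> K}).
Variable X : curve toK.

Local Notation N := (ambient_dim X).
Local Notation S := {mpoly K[N.+1]}.
Local Notation geompt := ('I_N.+1 -> K).
Local Notation ratpt := ('I_N.+1 -> k).

(* for a non-singular curve the genus is the arithmetic genus 1 - H(0) *)
Definition genus (g : nat) : Prop :=
  exists2 H : {poly rat}, hilbert_polynomial (ideal X) H & H.[0] = 1 - g%:R.

Definition geom (p : ratpt) : geompt := fun i => toK (p i).

Definition rational_point (p : ratpt) : Prop := zero_locus (ideal X) (geom p).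

(* The function fields K(X) and k(X) are the subfields of the fraction field of
   the homogeneous coordinate ring S / I consisting of the quotients of forms
   of the same degree over K, resp. over k. *)
Definition frac_coord_ring : fieldType := {fraction (prime_quot (ideal X))}.
Local Notation FR := frac_coord_ring.

Definition coord (a : S) : FR := tofrac (quot_class (ideal X) a).

Definition function_field : set FR :=
  [set x | exists (d : nat) (a b : {mpoly k[N.+1]}),
     [/\ a \is d.-homog, b \is d.-homog, map_mpoly toK b \notin ideal X &
         x = coord (map_mpoly toK a) / coord (map_mpoly toK b)]].

(* x is regular at p, with value c *)
Definition has_value (p : geompt) (x : FR) (c : K) : Prop :=
  exists (d : nat) (a b : S),
    [/\ a \is d.-homog, b \is d.-homog, b.@[p] != 0,
        x = coord a / coord b & c = a.@[p] / b.@[p]].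

Definition local_ring (p : geompt) : set FR := [set x | exists c, has_value p x c].

Definition max_ideal (p : geompt) : set FR := [set x | has_value p x 0].

Fixpoint max_ideal_pow (p : geompt) (e : nat) : set FR :=
  if e is e'.+1 then
    [set x | exists (s : nat) (y z : 'I_s -> FR),
       [/\ forall i, max_ideal p (y i), forall i, max_ideal_pow p e' (z i) &
           x = \sum_i y i * z i]]
  else local_ring p.

Definition has_order (p : geompt) (x : FR) (e : nat) : Prop :=
  max_ideal_pow p e x /\ forall e', max_ideal_pow p e' x -> (e' <= e)%N.

(* v_p(y / z) = ord_p(y) - ord_p(z) for y, z in the local ring at p; only
   meaningful for non-zero rational functions *)
Definition valuation (p : geompt) (x : FR) : int :=
  xget 0 [set v | exists y z e f,
    [/\ x = y / z, has_order p y e, has_order p z f & v = e%:Z - f%:Z]].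

(* E p is the coefficient of the divisor E at the point p *)
Definition riemann_roch_space (E : geompt -> int) : set FR :=
  [set x | function_field x /\
     (x = 0 \/ forall p, zero_locus (ideal X) p -> - E p <= valuation p x)].

Definition mult_point (m : nat) (Q : ratpt) : geompt -> int :=
  fun p => if `[< same_point (geom Q) p >] then m%:Z else 0.

Section Codes.
Variables (n : nat) (Q : ratpt) (P : 'I_n -> ratpt).

(* ev(L(mQ)); functions in k(X) take values in k at rational points *)
Definition codewords (m : nat) : {set 'rV[k]_n} :=
  [set c : 'rV[k]_n |
    `[< exists2 x, riemann_roch_space (mult_point m Q) x &
          forall j, has_value (geom (P j)) x (toK (c 0 j)) >]]%SET.

(* [codewords m] is already a linear subspace *)
Definition code (m : nat) : {vspace 'rV[k]_n} := <<enum (codewords m)>>%VS.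

(* C(D, -Q) = (0) *)
Definition Hstar (m : nat) : bool :=
  if m is m'.+1 then code m != code m' else code 0%N != 0%VS.

(* the element of H* with exactly j smaller ones; the index j starts at 0 *)
Definition mstar (j : nat) : nat :=
  xget 0%N [set m | Hstar m /\ count Hstar (iota 0%N m) = j].

Definition Lambda (j : nat) : set nat :=
  [set m | Hstar m /\ exists2 h, Hstar h & m = (mstar j + h)%N].

Definition dstar (r i : nat) : nat :=
  min_nat [set a | exists2 J : {set 'I_i}, #|J| = r &
                   a = #|` fset_set (\bigcup_(j in [set` J]) Lambda j)|%fset].

End Codes.
End Curve.

Section Weights.
Variables (F : finFieldType) (n : nat).

Definition supp (v : 'rV[F]_n) : {set 'I_n} := [set j | v 0 j != 0]%SET.

Definition supp_space (U : {vspace 'rV[F]_n}) : {set 'I_n} :=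
  (\bigcup_(v : 'rV[F]_n | v \in U) supp v)%SET.

Definition gen_hamming_weight (r : nat) (C : {vspace 'rV[F]_n}) : nat :=
  min_nat [set a | exists U : {vspace 'rV[F]_n},
             [/\ (U <= C)%VS, \dim U = r & a = #|supp_space U|]].

End Weights.

Arguments code {k K toK} X {n} Q P m.
Arguments dstar {k K toK} X {n} Q P r i.
Arguments rational_point {k K toK} X p.

(* Main.v *)
Require Import Defs.
From mathcomp Require Import all_boot all_order all_algebra all_field.
From HB Require Import structures.
From mathcomp Require Import finmap mpoly.
From mathcomp Require Import boolp classical_sets cardinality.
From mathcomp Require Import ring zify.

(* The order bound: give a word v of F_q^n the level rho(v), the least m with
   v in C(D, mQ). An r-dimensional subspace U of C(D, mQ) has exactly r levels,
   all among the first i elements of H^*. If rho(u) = a, rho(w) = b and a + b is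
   in H^*, the coordinatewise product u * w has level a + b, because the product
   of functions of pole orders a and b at Q has pole order a + b. For u in U
   these products are supported in supp(U), so the space of words supported
   there, of dimension #supp(U), has at least as many levels as there are
   elements in the union of the Lambda^*_j.

   This needs that L(zQ) / L((z-1)Q) has dimension at most 1 over k and that
   L(-Q) = 0. The Jacobian criterion, Euler's relation and Nakayama's lemma make
   every local ring have a principal maximal ideal; since the Hilbert polynomial
   is linear, any two functions are algebraically dependent, so no non-zero
   function lies in all powers of that ideal and the valuations are those of
   discrete valuation rings. A function without poles is constant: otherwise a
   place of the function field sending its inverse to 0 (Chevalley's extension
   theorem) would be centred at a point of the curve, where the function is
   regular. *)

Set Implicit Arguments.
Unset Strict Implicit.
Unset Printing Implicit Defensive.

Import Order.TTheory GRing.Theory Num.Theory.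

Local Open Scope classical_set_scope.
Local Open Scope ring_scope.

(** * Places *)

Section PartialMorphism.
Variables (K F : fieldType) (iota : {rmorphism K -> F}).

(** The graph of a [K]-algebra morphism from a subring of [F] to [K]. With a relation no subring has
    to be carried along; single-valuedness reduces by additivity to the last field. *)
Record partial_morphism (V : F -> K -> Prop) : Prop := PartialMorphism {
  pmorphC : forall c, V (iota c) c;
  pmorphD : forall x y a b, V x a -> V y b -> V (x + y) (a + b);
  pmorphM : forall x y a b, V x a -> V y b -> V (x * y) (a * b);
  pmorph0_inj : forall c, V 0 c -> c = 0 }.

Variables (V : F -> K -> Prop) (pV : partial_morphism V).

Lemma pmorph0 : V 0 0.
Proof. by have := pmorphC pV 0; rewrite rmorph0. Qed.

Lemma pmorph1 : V 1 1.
Proof. by have := pmorphC pV 1; rewrite rmorph1. Qed.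

Lemma pmorphN x a : V x a -> V (- x) (- a).
Proof.
move=> Vx; have := pmorphM pV (pmorphC pV (-1)) Vx.
by rewrite rmorphN1 !mulN1r.
Qed.

Lemma pmorphB x y a b : V x a -> V y b -> V (x - y) (a - b).
Proof. by move=> Vx Vy; apply: pmorphD => //; apply: pmorphN. Qed.

Lemma pmorph_inj x a b : V x a -> V x b -> a = b.
Proof.
move=> Va Vb; apply/eqP; rewrite -subr_eq0; apply/eqP.
by apply: (pmorph0_inj pV); rewrite -[X in V X _](subrr x); apply: pmorphB.
Qed.

Lemma pmorphX x a m : V x a -> V (x ^+ m) (a ^+ m).
Proof.
move=> Vx; elim: m => [|m IH]; first exact: pmorph1.
by rewrite !exprS; apply: (pmorphM pV).
Qed.

Lemma pmorph_sum I (r : seq I) (P : pred I) (x : I -> F) (a : I -> K) :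
  (forall i, P i -> V (x i) (a i)) ->
  V (\sum_(i <- r | P i) x i) (\sum_(i <- r | P i) a i).
Proof.
move=> Vx; apply: (big_ind2 V) => //; first exact: pmorph0.
by move=> *; apply: (pmorphD pV).
Qed.

Lemma pmorph_prod I (r : seq I) (P : pred I) (x : I -> F) (a : I -> K) :
  (forall i, P i -> V (x i) (a i)) ->
  V (\prod_(i <- r | P i) x i) (\prod_(i <- r | P i) a i).
Proof.
move=> Vx; apply: (big_ind2 V) => //; first exact: pmorph1.
by move=> *; apply: (pmorphM pV).
Qed.

Lemma pmorph_det m (A : 'M[F]_m) (B : 'M[K]_m) :
  (forall i j, V (A i j) (B i j)) -> V (\det A) (\det B).
Proof.
move=> VA; apply: pmorph_sum => s _; apply: (pmorphM pV).
  by apply: pmorphX; apply: pmorphN; apply: pmorph1.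
by apply: pmorph_prod.
Qed.

Lemma pmorph_cofactor m (A : 'M[F]_m) (B : 'M[K]_m) i j :
  (forall i j, V (A i j) (B i j)) -> V (cofactor A i j) (cofactor B i j).
Proof.
move=> VA; rewrite /cofactor; apply: (pmorphM pV).
  by apply: pmorphX; apply: pmorphN; apply: pmorph1.
by apply: pmorph_det => i' j'; rewrite !mxE.
Qed.

Lemma pmorph_horner (q : {poly F}) (r : {poly K}) x c : (forall i, V q`_i r`_i) -> V x c ->
  V q.[x] r.[c].
Proof.
move=> Vq Vx; rewrite (@horner_coef_wide _ (maxn (size q) (size r)) q) ?leq_maxl //.
rewrite (@horner_coef_wide _ (maxn (size q) (size r)) r) ?leq_maxr //.
by apply: pmorph_sum => i _; apply: (pmorphM pV) => //; apply: pmorphX.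
Qed.

Lemma pmorph_meval N (u : 'I_N -> F) (v : 'I_N -> K) (a : {mpoly K[N]}) :
  (forall i, V (u i) (v i)) -> V (mmap iota u a) a.@[v].
Proof.
move=> Vu; rewrite /meval /mmap; apply: pmorph_sum => m _.
apply: (pmorphM pV); first exact: (pmorphC pV).
by apply: pmorph_prod => i _; apply: pmorphX.
Qed.

End PartialMorphism.

Lemma trivial_place_pmorph (K F : fieldType) (iota : {rmorphism K -> F}) :
  partial_morphism iota (fun x c => x = iota c).
Proof.
split=> //.
- by move=> x y a b -> ->; rewrite rmorphD.
- by move=> x y a b -> ->; rewrite rmorphM.
- by move=> c /esym/eqP; rewrite fmorph_eq0 => /eqP.
Qed.

Lemma exprV_mulX (L : fieldType) (y : L) j m : y != 0 -> (j <= m)%N ->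
  y^-1 ^+ j * y ^+ m = y ^+ (m - j).
Proof.
by move=> y0 jm; rewrite -{1}(subnK jm) exprD mulrCA -exprMn mulVf // expr1n mulr1.
Qed.

(** * Chevalley's extension theorem *)

Section Chevalley.
Variables (K : closedFieldType) (F : fieldType) (iota : {rmorphism K -> F}).
Implicit Types V : F -> K -> Prop.

Definition adjoin_value V (x : F) (c : K) (y : F) (d : K) : Prop :=
  exists (q : {poly F}) (r : {poly K}), [/\ forall i, V q`_i r`_i, y = q.[x] & d = r.[c]].

(** Exactly what makes [adjoin_value], the extension of [V] sending [x] to [c], well defined:
    relations satisfied by [x] over the domain of [V] must reduce to relations satisfied by [c]. *)
Definition admissible_value V (x : F) (c : K) : Prop :=
  forall (q : {poly F}) (r : {poly K}), (forall i, V q`_i r`_i) -> q.[x] = 0 -> r.[c] = 0.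

Lemma pmorph_coefM V (q q' : {poly F}) (r r' : {poly K}) : partial_morphism iota V ->
  (forall i, V q`_i r`_i) -> (forall i, V q'`_i r'`_i) ->
  forall i, V (q * q')`_i (r * r')`_i.
Proof.
move=> pV Vq Vq' i; rewrite !coefM; apply: (pmorph_sum pV) => j _.
exact: (pmorphM pV).
Qed.

Lemma pmorph_coefC V x c : partial_morphism iota V -> V x c ->
  forall i, V (x%:P)`_i (c%:P)`_i.
Proof. by move=> pV Vx i; rewrite !coefC; case: eqP => // _; apply: pmorph0 pV. Qed.

Lemma adjoin_value_pmorph V x c : partial_morphism iota V ->
  admissible_value V x c -> partial_morphism iota (adjoin_value V x c).
Proof.
move=> pV adm; split.
- move=> d; exists (iota d)%:P, d%:P; rewrite !hornerC; split=> //.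
  by apply: pmorph_coefC => //; apply: (pmorphC pV).
- move=> _ _ _ _ [q [r [Vq -> ->]]] [q' [r' [Vq' -> ->]]].
  exists (q + q'), (r + r'); rewrite !hornerD; split=> // i.
  by rewrite !coefD; apply: (pmorphD pV).
- move=> _ _ _ _ [q [r [Vq -> ->]]] [q' [r' [Vq' -> ->]]].
  exists (q * q'), (r * r'); rewrite !hornerM; split=> //.
  exact: pmorph_coefM.
- by move=> d [q [r [Vq /esym q0 ->]]]; apply: adm q0.
Qed.

Lemma sub_adjoin_value V x c : partial_morphism iota V ->
  forall y d, V y d -> adjoin_value V x c y d.
Proof.
move=> pV y d Vy; exists y%:P, d%:P; rewrite !hornerC; split=> //.
exact: pmorph_coefC.
Qed.

Lemma adjoin_value_self V x c : partial_morphism iota V ->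
  adjoin_value V x c x c.
Proof.
move=> pV; exists 'X, 'X; rewrite !hornerX; split=> // i.
by rewrite !coefX; case: eqP => _; [apply: pmorph1 pV | apply: pmorph0 pV].
Qed.

Definition maximal_pmorph V : Prop :=
  partial_morphism iota V /\
  forall V', partial_morphism iota V' -> (forall x c, V x c -> V' x c) ->
    forall x c, V' x c -> V x c.

Lemma ex_maximal_pmorph V0 : partial_morphism iota V0 ->
  exists2 V, maximal_pmorph V & forall x c, V0 x c -> V x c.
Proof.
move=> pV0.
pose rel (A : set (F * K)) x c := A (x, c).
pose P (A : set (F * K)) := A = set0 \/
  (partial_morphism iota (rel A) /\ forall x c, V0 x c -> A (x, c)).
have [|A [PA maxA]] := @Zorn_bigcup (F * K)%type P.
  move=> C CP totC.
  have [[A CA A0]|noA] := pselect (exists2 A, C A & A <> set0); last first.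
    left; rewrite -subset0 => y [A CA Ay]; apply: noA; exists A => // A0.
    by rewrite A0 in Ay.
  have PC B : C B -> B <> set0 -> partial_morphism iota (rel B).
    by move=> /CP[|[]].
  have [|[pA V0A]] := CP _ CA; first by [].
  have up x y a b : (\bigcup_(X in C) X) (x, a) -> (\bigcup_(X in C) X) (y, b) ->
      exists B, [/\ C B, partial_morphism iota (rel B), B (x, a) & B (y, b)].
    move=> [B CB Bx] [B' CB' By].
    have ne D z : C D -> D z -> partial_morphism iota (rel D).
      by move=> CD Dz; apply: PC => // D0; rewrite D0 in Dz.
    by case: (totC _ _ CB CB') => sub; [exists B' | exists B]; split=> //;
      do ?[apply: ne; last eassumption]; do ?apply: sub.
  right; split; last by move=> x c /V0A ?; exists A.
  split.
  - by move=> c; exists A => //; apply: (pmorphC pA).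
  - move=> x y a b /up h /h[B [CB pB Bx By]]; exists B => //.
    exact: (pmorphD pB).
  - move=> x y a b /up h /h[B [CB pB Bx By]]; exists B => //.
    exact: (pmorphM pB).
  - by move=> c h; have [B [CB pB /(pmorph0_inj pB)]] := up _ _ _ _ h h.
have P0 : P [set z | V0 z.1 z.2] by right; split.
case: PA => [A0|[pA V0A]].
  case: (maxA _ _ P0); rewrite A0; split=> // /(_ (0, 0)); apply.
  exact: pmorph0 pV0.
exists (rel A) => //; split=> // V' pV' AV' x c V'x.
apply: contrapT => nA; apply: (maxA [set z | V' z.1 z.2]).
  split=> [[y d]|/(_ (x, c)) sub]; [exact: AV' | exact/nA/sub].
by right; split=> // y d /V0A; apply: AV'.
Qed.

Section MaximalPlace.
Variables (V : F -> K -> Prop) (maxV : maximal_pmorph V).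
Let pV : partial_morphism iota V := maxV.1.

Lemma maximal_pmorph_adjoin x c : admissible_value V x c -> V x c.
Proof.
move=> adm; apply: maxV.2 (adjoin_value_pmorph pV adm) _ _ _ _.
  exact: sub_adjoin_value.
exact: adjoin_value_self.
Qed.

(** By maximality it is enough that [c^-1] be admissible for [x^-1]: multiplying a relation of
    [x^-1] by a power of [x] turns it into an identity inside the domain of [V], where it can be
    reduced. *)
Lemma maximal_pmorphV x c : V x c -> c != 0 -> V x^-1 c^-1.
Proof.
move=> Vx c0; have x0 : x != 0.
  by apply: contraNneq c0 => x0; rewrite x0 in Vx; rewrite (pmorph0_inj pV Vx).
apply: maximal_pmorph_adjoin => q r Vq qx0.
pose m := maxn (size q) (size r).
have E (L : fieldType) (s : {poly L}) y : y != 0 -> (size s <= m)%N ->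
    s.[y^-1] * y ^+ m = \sum_(i < m) s`_i * y ^+ (m - i).
  move=> y0 sm; rewrite (horner_coef_wide _ sm) mulr_suml.
  apply: eq_bigr => i _; rewrite -mulrA; congr (_ * _).
  by rewrite exprV_mulX // ltnW.
have: V (q.[x^-1] * x ^+ m) (r.[c^-1] * c ^+ m).
  rewrite !E ?leq_maxl ?leq_maxr //; apply: (pmorph_sum pV) => i _.
  by apply: (pmorphM pV) => //; apply: (pmorphX pV _ Vx).
rewrite qx0 mul0r => /(pmorph0_inj pV)/eqP.
by rewrite mulf_eq0 expf_eq0 (negPf c0) andbF orbF => /eqP.
Qed.

(** The reductions of the relations of [x] form an ideal of [K[T]]. If it is zero, every value is
    admissible; if it is proper and non-zero, a root of its generator is, as [K] is algebraically
    closed; otherwise it contains 1. *)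
Lemma unit_value_or_unit_relation x : (exists c, V x c) \/
  exists q : {poly F}, (forall i, V q`_i (1%:P : {poly K})`_i) /\ q.[x] = 0.
Proof.
have [[c adm]|nadm] := pselect (exists c, admissible_value V x c).
  by left; exists c; apply: maximal_pmorph_adjoin.
right; pose I (r : {poly K}) := exists q : {poly F}, (forall i, V q`_i r`_i) /\ q.[x] = 0.
have ID r s a : I r -> I s -> I (r - a * s).
  move=> [q [Vq q0]] [p [Vp p0]]; exists (q - map_poly iota a * p).
  rewrite !hornerE q0 p0 mulr0 subr0; split=> // i; rewrite !coefB.
  apply: (pmorphB pV) => //; apply: pmorph_coefM => // j.
  by rewrite coef_map; apply: (pmorphC pV).
have [r Ir r0] : exists2 r, I r & r != 0.
  apply: contrapT => h; apply: nadm; exists 0 => q r Vq q0.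
  have [->|r0] := eqVneq r 0; first by rewrite horner0.
  by case: h; exists r => //; exists q.
have : exists m, `[< exists r, [/\ I r, r != 0 & size r = m] >].
  by exists (size r); apply/asboolP; exists r.
move=> /ex_minnP[m /asboolP[{r Ir r0} r [Ir r0 sr]] minm].
have dvd s : I s -> r %| s.
  move=> Is; apply: contrapT => /negP; rewrite /dvdp => h.
  have := minm (size (s %% r)); rewrite -sr leqNgt ltn_modp r0 => /(_ _)/negP[] //.
  apply/asboolP; exists (s %% r); split=> //.
  have -> : s %% r = s - (s %/ r) * r by rewrite {2}(divp_eq s r) addrC addKr.
  exact: ID.
have [/eqP r1|r1] := boolP (size r == 1%N).
  have /size_poly1P[c c0 rE] : size r == 1%N by rewrite r1.
  have [q [Vq q0]] := Ir; exists ((iota c^-1)%:P * q); rewrite !hornerE q0 mulr0.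
  split=> // i; have -> : (1%:P : {poly K}) = (c^-1)%:P * r.
    by rewrite rE -polyCM mulVf.
  by apply: pmorph_coefM => //; apply: pmorph_coefC => //; apply: (pmorphC pV).
have /closed_rootP[c rc] := r1.
case: nadm; exists c => q s Vq q0; apply/rootP.
by apply: root_dvdp rc; apply: dvd; exists q.
Qed.

(** Descent on the total size: a relation reducing to 1 for whichever of [x], [x^-1] has the larger
    one is shortened by means of the other relation, until it is a constant equal to 0 that would
    reduce to 1. *)
Lemma unit_relations_absurd x (q p : {poly F}) : x != 0 ->
  (forall i, V q`_i (1%:P : {poly K})`_i) -> q.[x] = 0 ->
  (forall i, V p`_i (1%:P : {poly K})`_i) -> p.[x^-1] = 0 -> False.
Proof.
have [m] := ubnP (size q + size p); elim: m => // m IH in x q p *.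
wlog le_pq : x q p / (size p <= size q)%N.
  move=> gen; have [le|/ltnW le] := leqP (size p) (size q); first exact: gen.
  rewrite addnC -(invr_eq0 x) => sm x0 Vq qx Vp px.
  by apply: (gen x^-1 p q) => //; rewrite invrK.
rewrite ltnS => sm x0 Vq qx Vp px.
have p0 : p`_0 != 0.
  apply/eqP => p0; have := Vp 0%N; rewrite p0 coefC => /(pmorph0_inj pV)/eqP.
  by rewrite oner_eq0.
have [q1|q1] := leqP (size q) 1.
  move: qx; rewrite (size1_polyC q1) hornerC => q0.
  have := Vq 0%N; rewrite q0 coefC => /(pmorph0_inj pV)/eqP.
  by rewrite oner_eq0.
have sp : (0 < size p)%N by rewrite size_poly_gt0; apply: contraNneq p0 => ->; rewrite coef0.
pose n := (size q).-1; pose d := (size p).-1.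
have qn : (size q = n.+1)%N by rewrite prednK // ltnW.
have pd : (size p = d.+1)%N by rewrite prednK.
have le_dn : (d <= n)%N by rewrite -ltnS -qn -pd.
have n0 : (0 < n)%N by rewrite -ltnS -qn.
(* The reversal of [p], a relation of [x] whose coefficient of degree [d] is the constant term of
   [p], a unit. *)
pose s : {poly F} := \poly_(i < d.+1) p`_(d - i).
have sx : s.[x] = 0.
  have xd0 : x^-1 ^+ d != 0 by rewrite expf_neq0 ?invr_eq0.
  apply: (mulfI xd0); rewrite mulr0 -[RHS]px (@horner_coef_wide _ d.+1 s) ?size_poly //.
  rewrite (@horner_coef_wide _ d.+1 p) ?pd // mulr_sumr [RHS](reindex_inj rev_ord_inj) /=.
  apply: eq_bigr => i _; rewrite coef_poly ltn_ord subSS mulrCA; congr (_ * _).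
  by rewrite mulrC -{1}(invrK x) exprV_mulX ?leq_ord ?invr_eq0.
(* This multiple of the shifted [s] cancels the leading term of [q]; since [n > 0], [q_n] and hence
   [b] reduce to 0, so the difference still reduces to 1. *)
pose b := q`_n / p`_0.
have Vb : V b 0.
  rewrite /b -(mul0r (1^-1 : K)); apply: (pmorphM pV).
    by have := Vq n; rewrite coefC (gtn_eqF n0).
  apply: maximal_pmorphV; last exact: oner_neq0.
  by have := Vp 0%N; rewrite coefC.
pose q' := q - b%:P * 'X^(n - d) * s.
apply: (IH x q' p) => //.
- have sq' : (size q' <= n)%N.
    apply/leq_sizeP => j; rewrite leq_eqVlt => /orP[/eqP<-|nj].
      rewrite /q' coefB -mulrA coefCM coefXnM ltnNge leq_subr /= subKn //.
      by rewrite coef_poly ltnS leqnn subnn /b divfK // subrr.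
    rewrite /q' coefB nth_default ?qn // -mulrA coefCM coefXnM.
    rewrite ltnNge (leq_trans (leq_subr _ _) (ltnW nj)) /= coef_poly.
    rewrite ltnS leqNgt ltn_subRL subnK // nj /= mulr0 subr0 //.
  by apply: leq_trans sm; rewrite qn addSn ltnS leq_add2r.
- move=> i; rewrite /q' coefB -mulrA coefCM coefXnM.
  rewrite -[X in V _ X]subr0; apply: (pmorphB pV) => //.
  have [_|le_i] := ltnP i (n - d); first by rewrite mulr0; apply: pmorph0 pV.
  rewrite coef_poly ltnS; case: leqP => _; last by rewrite mulr0; apply: pmorph0 pV.
  rewrite -(mul0r ((1%:P : {poly K})`_(d - (i - (n - d))))).
  exact: (pmorphM pV).
- by rewrite /q' !hornerE qx sx mulr0 subr0.
Qed.

Lemma maximal_pmorph_total x : x != 0 ->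
  (exists c, V x c) \/ (exists c, V x^-1 c).
Proof.
move=> x0; have [|[q [Vq qx]]] := unit_value_or_unit_relation x; first by left.
have [|[p [Vp px]]] := unit_value_or_unit_relation x^-1; first by right.
by case: (unit_relations_absurd x0 Vq qx Vp px).
Qed.

End MaximalPlace.

(** Since [K] is algebraically closed, a non-constant [x] is transcendental over it, so 0 is an
    admissible value over the constants; a maximal extension then exists by Zorn's lemma. *)
Lemma exists_place x : (forall c, x != iota c) ->
  exists2 V, maximal_pmorph V & V x 0.
Proof.
move=> xK; have pT := trivial_place_pmorph iota.
have adm : admissible_value (fun x c => x = iota c) x 0.
  move=> q r qr; have -> : q = map_poly iota r.
    by apply/polyP => i; rewrite coef_map.
  have [->|r0] := eqVneq r 0; first by rewrite horner0.
  have [s rE] := closed_field_poly_normal r.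
  rewrite rE map_polyZ rmorph_prod hornerZ horner_prod /= => /eqP.
  rewrite mulf_eq0 fmorph_eq0 lead_coef_eq0 (negPf r0) /= prodf_seq_eq0.
  move=> /hasP[c _]; rewrite /= rmorphB /= map_polyX map_polyC hornerXsubC.
  by rewrite subr_eq0 (negPf (xK c)).
have [V maxV sub] := ex_maximal_pmorph (adjoin_value_pmorph pT adm).
by exists V => //; apply/sub/adjoin_value_self.
Qed.

End Chevalley.

(** * Discrete valuation rings *)

Section DiscreteValuation.
Variables (K F : fieldType) (iota : {rmorphism K -> F}).
Variables (V : F -> K -> Prop) (pV : partial_morphism iota V).
Hypothesis V_inv : forall x c, V x c -> c != 0 -> V x^-1 c^-1.
Variable t : F.
Hypothesis Vt : V t 0.
Hypothesis V_gen : forall x, V x 0 -> exists y c, V y c /\ x = t * y.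

Definition pow_dvd (e : nat) (x : F) : Prop :=
  exists y c, V y c /\ x = t ^+ e * y.

(** The clause [x != 0] is a real condition: [t] may be 0 here, and then [t ^+ e * u] vanishes for
    [e > 0]. *)
Definition order_at (x : F) (e : nat) : Prop :=
  exists u c, [/\ V u c, c != 0, x = t ^+ e * u & x != 0].

Lemma value_unit_neq0 u c : V u c -> c != 0 -> u != 0.
Proof.
by move=> Vu; apply: contraNneq => u0; rewrite u0 in Vu; rewrite (pmorph0_inj pV Vu).
Qed.

Lemma pow_dvd0 x c : V x c -> pow_dvd 0 x.
Proof. by move=> Vx; exists x, c; rewrite mul1r. Qed.

Lemma pow_dvd_zero e : pow_dvd e 0.
Proof. by exists 0, 0; rewrite mulr0; split=> //; apply: pmorph0 pV. Qed.

Lemma pow_dvdD e x y : pow_dvd e x -> pow_dvd e y -> pow_dvd e (x + y).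
Proof.
move=> [u [a [Vu ->]]] [v [b [Vv ->]]]; exists (u + v), (a + b).
by rewrite mulrDr; split=> //; apply: (pmorphD pV).
Qed.

Lemma pow_dvd_le e e' x : (e' <= e)%N -> pow_dvd e x -> pow_dvd e' x.
Proof.
move=> le [u [a [Vu ->]]]; exists (t ^+ (e - e') * u), (0 ^+ (e - e') * a).
rewrite mulrA -exprD subnKC //; split=> //.
by apply: (pmorphM pV) => //; apply: (pmorphX pV).
Qed.

Lemma order_at_dvd x e e' : order_at x e -> pow_dvd e' x <-> (e' <= e)%N.
Proof.
move=> [u [c [Vu c0 xE x0]]]; split; last first.
  by move=> le; apply: pow_dvd_le le _; exists u, c.
move=> [v [d [Vv xE']]]; rewrite leqNgt; apply/negP => lt.
have te : t ^+ e != 0 by apply: contraNneq x0 => h; rewrite xE h mul0r.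
have uE : u = t ^+ (e' - e) * v.
  by apply: (mulfI te); rewrite -xE xE' mulrA -exprD subnKC // ltnW.
have V0 : V u 0.
  have := pmorphM pV (pmorphX pV (e' - e) Vt) Vv.
  by rewrite -uE expr0n subn_eq0 leqNgt lt mul0r.
by move: c0; rewrite (pmorph_inj pV Vu V0) eqxx.
Qed.

Lemma order_at_inj x e e' : order_at x e -> order_at x e' -> e = e'.
Proof.
move=> h h'; apply/eqP; rewrite eqn_leq.
apply/andP; split.
  by apply/(order_at_dvd _ h')/(order_at_dvd _ h).
by apply/(order_at_dvd _ h)/(order_at_dvd _ h').
Qed.

Lemma order_atM x y e f : order_at x e -> order_at y f ->
  order_at (x * y) (e + f).
Proof.
move=> [u [c [Vu c0 xE x0]]] [v [d [Vv d0 yE y0]]].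
exists (u * v), (c * d); split; rewrite ?mulf_neq0 //; first exact: (pmorphM pV).
by rewrite xE yE exprD mulrACA.
Qed.

(** If the cofactor of the largest power of [t] had value 0, it would be divisible by [t] once more;
    so it is a unit. *)
Lemma has_orderP x e : (pow_dvd e x /\ forall e', pow_dvd e' x -> (e' <= e)%N) <->
  order_at x e.
Proof.
split=> [[dx max]|ox]; last first.
  by split=> [|e']; [apply/(order_at_dvd _ ox) | move/(order_at_dvd _ ox)].
have x0 : x != 0.
  by apply/eqP => x0; have := max e.+1; rewrite x0 ltnn => /(_ (pow_dvd_zero _)).
have [u [c [Vu xE]]] := dx; exists u, c; split=> //; apply/eqP => c0.
rewrite c0 in Vu; have [v [d [Vv uE]]] := V_gen Vu.
have : pow_dvd e.+1 x by exists v, d; rewrite xE uE exprSr mulrA.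
by move/max; rewrite ltnn.
Qed.

(** A relation P(t, x) = 0 in two variables, the inner one standing for [t]. It takes the place of a
    Noetherian hypothesis in showing that the powers of the maximal ideal meet in 0. *)
Hypothesis algebraic_dependence : forall x c, V x c ->
  exists2 P : {poly {poly K}}, P != 0 &
    (map_poly (horner_eval t \o map_poly iota) P).[x] = 0.

(** Write q = T^m r with r(0) non-zero: then q(t) is t^m times a unit, so t^(m+1) does not divide
    it. *)
Lemma poly_uniformizer_dvd (q : {poly K}) : t != 0 -> q != 0 ->
  exists e, ~ pow_dvd e (map_poly iota q).[t].
Proof.
move=> t0 q0; have [m [r]] := multiplicity_XsubC q 0.
rewrite q0 polyC0 subr0 /= => r0 qE; exists m.+1 => -[y [c [Vy]]].
rewrite qE rmorphM rmorphXn /= map_polyX.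
rewrite hornerM hornerXn mulrC exprSr -mulrA => /(mulfI (expf_neq0 _ t0)) rt.
have Vr : V (map_poly iota r).[t] r.[0].
  by apply: (pmorph_horner pV) => // i; rewrite coef_map; apply: (pmorphC pV).
move: r0; rewrite /root (pmorph_inj pV Vr (_ : V _ 0)) ?eqxx //.
by rewrite rt -(mul0r c); apply: (pmorphM pV).
Qed.

(** Removing the powers of the outer variable from the relation of [x] leaves R with R(x) = 0 and
    non-zero constant term R(0). Then R(0), evaluated at [t], is a multiple of [x], so it would be
    divisible by all powers of [t] if [x] were, against [poly_uniformizer_dvd]. *)
Lemma krull_intersection x c : x != 0 -> V x c -> exists e, ~ pow_dvd e x.
Proof.
move=> x0 Vx; apply: contrapT => h.
have dx e : pow_dvd e x by apply: contrapT => ne; apply: h; exists e.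
have t0 : t != 0.
  by have [y [d [_ xE]]] := dx 1%N; apply: contraNneq x0 => t0; rewrite xE t0 mul0r.
pose phi := [the {rmorphism {poly K} -> F} of horner_eval t \o map_poly iota].
have [P P0 Px] : exists2 P : {poly {poly K}}, P != 0 & (map_poly phi P).[x] = 0.
  exact: algebraic_dependence Vx.
have [m [R]] := multiplicity_XsubC P 0; rewrite P0 polyC0 subr0 /= => R0 PE.
have Rx : (map_poly phi R).[x] = 0.
  move: Px; rewrite PE rmorphM rmorphXn /= map_polyX hornerM hornerXn => /eqP.
  by rewrite mulf_eq0 expf_eq0 (negPf x0) andbF orbF => /eqP.
have [S SE] : exists S, R - (R.[0])%:P = S * 'X.
  have /factor_theorem[S SE] : root (R - (R.[0])%:P) 0 by rewrite /root !hornerE subrr.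
  by exists S; rewrite SE polyC0 subr0.
have VS : V (map_poly phi S).[x] (map_poly (horner_eval 0) S).[c].
  apply: (pmorph_horner pV) => // i; rewrite !coef_map /=.
  by apply: (pmorph_horner pV) => // j; rewrite coef_map; apply: (pmorphC pV).
have [e] := poly_uniformizer_dvd t0 R0; apply.
have -> : (map_poly iota R.[0]).[t] = - (map_poly phi S).[x] * x.
  have : (map_poly phi (R - (R.[0])%:P)).[x] = (map_poly phi (S * 'X)).[x].
    by rewrite SE.
  rewrite rmorphB rmorphM /= map_polyX !map_polyC /= !hornerE Rx sub0r => h'.
  by rewrite mulNr -h' opprK.
have [y [d [Vy xE]]] := dx e; rewrite {2}xE mulrCA.
by eexists; eexists; split; first exact: (pmorphM pV (pmorphN pV VS) Vy).
Qed.

Lemma order_at_exists x c : x != 0 -> V x c -> exists e, order_at x e.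
Proof.
move=> x0 Vx; have [e0 ne0] := krull_intersection x0 Vx.
have ex : exists e, `[< ~ pow_dvd e x >] by exists e0; apply/asboolP.
case: (ex_minnP ex) => -[|e] /asboolP ne min; first by case: ne; apply: pow_dvd0 Vx.
exists e; apply/has_orderP; split.
  apply: contrapT => ne'; have := min e; rewrite ltnn => h.
  by have := h (introT (asboolP _) ne').
by move=> e' d'; rewrite leqNgt; apply/negP => lt; apply: ne; apply: pow_dvd_le d'.
Qed.

Lemma order_atD x y e f g : order_at x e -> order_at y f -> x + y != 0 ->
  (g <= e)%N -> (g <= f)%N -> exists2 h, order_at (x + y) h & (g <= h)%N.
Proof.
move=> ox oy xy0 ge gf.
have d : pow_dvd g (x + y).
  by apply: pow_dvdD; [apply/(order_at_dvd _ ox) | apply/(order_at_dvd _ oy)].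
have [u [c [Vu uE]]] := d.
have Vxy : V (x + y) (0 ^+ g * c).
  by rewrite uE; apply: (pmorphM pV) => //; apply: (pmorphX pV).
have [h oh] := order_at_exists xy0 Vxy; exists h => //.
exact/(order_at_dvd _ oh).
Qed.

Definition is_valuation (x : F) (v : int) : Prop :=
  exists y z e f,
    [/\ x = y / z, order_at y e, order_at z f & v = e%:Z - f%:Z].

Lemma order_at_neq0 x e : order_at x e -> x != 0.
Proof. by case=> u [c []]. Qed.

Lemma is_valuation_neq0 x v : is_valuation x v -> x != 0.
Proof.
move=> [y [z [e [f [-> /order_at_neq0 y0 /order_at_neq0 z0 _]]]]].
by rewrite mulf_neq0 ?invr_neq0.
Qed.

Lemma is_valuation_inj x v w : is_valuation x v -> is_valuation x w -> v = w.
Proof.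
move=> [y [z [e [f [xE oy oz ->]]]]] [y' [z' [e' [f' [xE' oy' oz' ->]]]]].
have E : y * z' = y' * z.
  apply/eqP; rewrite -eqr_div ?(order_at_neq0 oz) ?(order_at_neq0 oz') //.
  by rewrite -xE -xE'.
have := order_atM oy oz'; rewrite E => /(order_at_inj (order_atM oy' oz)).
lia.
Qed.

Lemma is_valuationM x y v w : is_valuation x v -> is_valuation y w ->
  is_valuation (x * y) (v + w).
Proof.
move=> [y1 [z1 [e1 [f1 [-> oy1 oz1 ->]]]]] [y2 [z2 [e2 [f2 [-> oy2 oz2 ->]]]]].
exists (y1 * y2), (z1 * z2), (e1 + e2)%N, (f1 + f2)%N; split.
- by rewrite invfM mulrACA.
- exact: order_atM.
- exact: order_atM.
- lia.
Qed.

Lemma is_valuationV x v : is_valuation x v -> is_valuation x^-1 (- v).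
Proof.
move=> [y [z [e [f [-> oy oz ->]]]]]; exists z, y, f, e.
by rewrite invf_div opprB.
Qed.

Lemma is_valuationD x y v w b : is_valuation x v -> is_valuation y w ->
  x + y != 0 -> b <= v -> b <= w ->
  exists2 c, is_valuation (x + y) c & b <= c.
Proof.
move=> [y1 [z1 [e1 [f1 [-> oy1 oz1 ->]]]]] [y2 [z2 [e2 [f2 [-> oy2 oz2 ->]]]]].
rewrite addf_div ?(order_at_neq0 oz1) ?(order_at_neq0 oz2) // => xy0 bv bw.
have s0 : y1 * z2 + y2 * z1 != 0 by apply: contraNneq xy0 => ->; rewrite mul0r.
have [h oh gh] := order_atD (order_atM oy1 oz2) (order_atM oy2 oz1) s0
  (geq_minl _ _) (geq_minr _ _).
exists (h%:Z - (f1 + f2)%N%:Z); last by lia.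
exists (y1 * z2 + y2 * z1), (z1 * z2), h, (f1 + f2)%N; split=> //.
exact: order_atM.
Qed.

Lemma is_valuation_exists y z c d : y != 0 -> z != 0 -> V y c -> V z d ->
  exists v, is_valuation (y / z) v.
Proof.
move=> y0 z0 Vy Vz.
have [e oy] := order_at_exists y0 Vy; have [f oz] := order_at_exists z0 Vz.
by exists (e%:Z - f%:Z), y, z, e, f.
Qed.

Lemma is_valuation_ge0 x v : is_valuation x v -> 0 <= v -> exists c, V x c.
Proof.
move=> [y [z [e [f [-> [u [c [Vu c0 yE y0]]] [w [d [Vw d0 zE z0]]] ->]]]]] vge.
have fe : (f <= e)%N by lia.
have tf : t ^+ f != 0 by apply: contraNneq z0 => h; rewrite zE h mul0r.
have -> : y / z = t ^+ (e - f) * (u / w).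
  rewrite yE zE -{1}(subnKC fe) exprD; field.
  by rewrite tf (value_unit_neq0 Vw d0).
exists (0 ^+ (e - f) * (c / d)); apply: (pmorphM pV); first exact: (pmorphX pV).
by apply: (pmorphM pV) => //; apply: V_inv.
Qed.

Lemma value_valuation x v c : V x c -> is_valuation x v ->
  0 <= v /\ (c == 0) = (0 < v).
Proof.
move=> Vx vx; have x0 := is_valuation_neq0 vx.
have [e oe] := order_at_exists x0 Vx.
have o1 : order_at 1 0.
  by exists 1, 1; split; rewrite ?mul1r ?oner_neq0 //; apply: pmorph1 pV.
have -> : v = e%:Z.
  apply: is_valuation_inj vx _; exists x, 1, e, 0%N.
  by rewrite divr1 subr0.
split=> //; have [u [d [Vu d0 xE _]]] := oe.
have -> : c = 0 ^+ e * d.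
  apply: (pmorph_inj pV Vx); rewrite xE.
  by apply: (pmorphM pV) => //; apply: (pmorphX pV).
by rewrite mulf_eq0 (negPf d0) orbF expf_eq0 eqxx andbT; case: (e).
Qed.

End DiscreteValuation.

(** * The order bound for filtered codes *)

Lemma min_nat_le (A : set nat) a : A a -> (min_nat A <= a)%N.
Proof.
move=> Aa; have ex : exists b, `[< A b >] by exists a; apply/asboolP.
have [m /asboolP Am minm] := ex_minnP ex.
have [_] : [set b | A b /\ forall c, A c -> (b <= c)%N] (min_nat A).
  by apply: (@xgetI _ 0%N _ m); split=> // c Ac; apply/minm/asboolP.
exact.
Qed.

Lemma min_nat_mem (A : set nat) a : A a -> A (min_nat A).
Proof.
move=> Aa; have ex : exists b, `[< A b >] by exists a; apply/asboolP.
have [m /asboolP Am minm] := ex_minnP ex.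
have [] : [set b | A b /\ forall c, A c -> (b <= c)%N] (min_nat A) => //.
by apply: (@xgetI _ 0%N _ m); split=> // c Ac; apply/minm/asboolP.
Qed.

(** It makes the set minimized in [gen_hamming_weight] non-empty, so the weight is attained and is
    not the default 0. *)
Lemma subspace_of_dim (K : fieldType) (vT : vectType K) (V : {vspace vT}) r :
  (r <= \dim V)%N -> exists2 U : {vspace vT}, (U <= V)%VS & \dim U = r.
Proof.
move=> le; exists <<take r (vbasis V)>>%VS.
  by apply/span_subvP => v /mem_take/vbasis_mem.
apply/eqP; have := basis_free (vbasisP V).
rewrite -{1}(cat_take_drop r (vbasis V)) => /catl_free.
by rewrite /free size_takel // size_tuple.
Qed.

Section OrderBound.
Variables (F : finFieldType) (n : nat) (C : nat -> {vspace 'rV[F]_n}).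

Definition prev_code (m : nat) : {vspace 'rV[F]_n} :=
  if m is m'.+1 then C m' else 0%VS.

Definition schur (u w : 'rV[F]_n) : 'rV[F]_n := \row_j (u 0 j * w 0 j).

Hypothesis prev_code_sub : forall m, (prev_code m <= C m)%VS.
Hypothesis code_jump : forall m u w,
  u \in C m -> u \notin prev_code m -> w \in C m ->
  exists c, w - c *: u \in prev_code m.
(** The last premise says that [a + b] is in H^*. Otherwise the values of a product with pole order
    [a + b] are also those of a function of smaller pole order. *)
Hypothesis schur_jump : forall a b u w,
  u \in C a -> u \notin prev_code a -> w \in C b -> w \notin prev_code b ->
  C (a + b)%N != prev_code (a + b) ->
  schur u w \in C (a + b)%N /\ schur u w \notin prev_code (a + b).

(** Says that [m] is the level of some word of [V]; for the full space this is membership in H^*. *)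
Definition jumps (V : {vspace 'rV[F]_n}) (m : nat) : bool :=
  (V :&: C m != V :&: prev_code m)%VS.

Lemma jumps_witness V m : jumps V m ->
  exists u, [/\ u \in V, u \in C m & u \notin prev_code m].
Proof.
rewrite /jumps eqEsubv (capvS (subvv V) (prev_code_sub m)) andbT.
move=> /subvPn[u /memv_capP[uV uC]].
by rewrite memv_cap uV => up; exists u.
Qed.

Lemma witness_jumps (V : {vspace 'rV[F]_n}) m u :
  u \in V -> u \in C m -> u \notin prev_code m ->
  jumps V m.
Proof.
move=> uV uC up; rewrite /jumps eqEsubv negb_and; apply/orP; left.
by apply/subvPn; exists u; rewrite memv_cap uV.
Qed.

(** By [code_jump], one word of level [m] in [V] spans the words of [V] of level at most [m] modulo
    those of smaller level. Summed over [m], this shows that dimension counts levels. *)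
Lemma dim_cap_jump V m :
  \dim (V :&: C m) = (\dim (V :&: prev_code m) + jumps V m)%N.
Proof.
have [jVm|] := boolP (jumps V m); last first.
  by rewrite /jumps negbK => /eqP->; rewrite addn0.
have [u [uV uC up]] := jumps_witness jVm.
have u0 : u != 0 by apply: contraNneq up => ->; rewrite mem0v.
have -> : (V :&: C m = V :&: prev_code m + <[u]>)%VS.
  apply/eqP; rewrite eqEsubv; apply/andP; split; last first.
    by rewrite subv_add capvS //= -memvE memv_cap uV.
  apply/subvP => w /memv_capP[wV wC].
  have [c wp] := code_jump uC up wC; apply/memv_addP.
  exists (w - c *: u); first by rewrite memv_cap wp andbT rpredB ?rpredZ.
  by exists (c *: u); rewrite ?rpredZ ?memv_line // subrK.
rewrite dimv_disjoint_sum ?dim_vline ?u0 //.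
apply/eqP; rewrite -subv0; apply/subvP => w /memv_capP[/memv_capP[_ wp]].
move=> /vlineP[c wE]; rewrite wE in wp *.
have [->|c0] := eqVneq c 0; first by rewrite scale0r mem0v.
by move: wp; rewrite rpredZeq (negPf c0) (negPf up).
Qed.

Lemma dim_cap_count V m :
  \dim (V :&: C m) = count (jumps V) (iota 0%N m.+1).
Proof.
elim: m => [|m IH]; first by rewrite dim_cap_jump capv0 dimv0 /= addn0.
by rewrite dim_cap_jump [prev_code _]/= IH -(addn1 m.+1) iotaD count_cat /= addn0.
Qed.

Lemma schur_supported (S : {set 'I_n}) u w : supp u \subset S ->
  schur u w \in <<[seq delta_mx 0%R j | j <- enum S]>>%VS.
Proof.
move=> uS; rewrite (row_sum_delta (schur u w)); apply: rpred_sum => j _.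
rewrite mxE; have [->|u0] := eqVneq (u 0 j) 0; first by rewrite mul0r scale0r mem0v.
apply/rpredZ/memv_span/map_f; rewrite mem_enum; apply: (fintype.subsetP uS).
by rewrite inE.
Qed.

Lemma order_bound (U : {vspace 'rV[F]_n}) (A : {fset nat}) :
  (forall x, x \in A -> jumps fullv x /\
     exists a b, [/\ jumps U a, jumps fullv b & x = (a + b)%N]) ->
  (#|` A| <= #|supp_space U|)%N.
Proof.
(* The space of words supported in supp(U). It contains all products [schur u w] with [u] in [U], so
   every element of [A] is one of its levels, and its dimension is at most #supp(U). *)
move=> AP; pose E : {vspace 'rV[F]_n} :=
  <<[seq delta_mx 0%R j | j <- enum (supp_space U)]>>%VS.
pose M := (\max_(x <- A) x)%N.
apply: (@leq_trans (count (jumps E) (iota 0 M.+1))).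
  rewrite -size_filter; apply: uniq_leq_size; first exact: fset_uniq.
  move=> x xA; rewrite mem_filter mem_iota add0n ltnS leq0n /=.
  rewrite (leq_bigmax_seq x xA isT) andbT.
  have [jx [a [b [/jumps_witness[u [uU uC up]] /jumps_witness[w [_ wC wp]] xE]]]] := AP _ xA.
  move: jx; rewrite /jumps !capfv xE => jx.
  have [sC sp] := schur_jump uC up wC wp jx.
  apply: witness_jumps sC sp; apply: schur_supported.
  by rewrite /supp_space; apply: finset.bigcup_sup.
rewrite -dim_cap_count (leq_trans (dimvS (capvSl _ _))) //.
by rewrite (leq_trans (dim_span _)) // size_map -cardE.
Qed.

End OrderBound.

Lemma count_iota_lt (p : pred nat) a b : p a -> (a < b)%N ->
  (count p (iota 0 a) < count p (iota 0 b))%N.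
Proof.
move=> pa ab; rewrite -(subnKC ab) addSnnS iotaD count_cat /= add0n pa.
by rewrite -addn1 leq_add2l.
Qed.

(** * From levels to generalized Hamming weights *)

Section WeightBound.
Variables (k : finFieldType) (K : closedFieldType) (toK : {rmorphism k -> K}).
Variables (X : curve toK) (n : nat) (Q : 'I_(ambient_dim X).+1 -> k).
Variable P : 'I_n -> 'I_(ambient_dim X).+1 -> k.
Local Notation C := (code X Q P).

Lemma HstarE m : Hstar Q P m = jumps C fullv m.
Proof. by rewrite /jumps !capfv; case: m. Qed.

Lemma mstar_count a : Hstar Q P a ->
  mstar Q P (count (Hstar Q P) (iota 0 a)) = a.
Proof.
move=> Ha; apply: xget_unique => // b [Hb cb].
case: (ltngtP b a) => // lt.
  by have := count_iota_lt Hb lt; rewrite cb ltnn.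
by have := count_iota_lt Ha lt; rewrite cb ltnn.
Qed.

Hypothesis sub : forall m, (prev_code C m <= C m)%VS.
Hypothesis jump : forall m u w,
  u \in C m -> u \notin prev_code C m -> w \in C m ->
  exists c, w - c *: u \in prev_code C m.
Hypothesis mul_jump : forall a b u w,
  u \in C a -> u \notin prev_code C a -> w \in C b -> w \notin prev_code C b ->
  C (a + b)%N != prev_code C (a + b) ->
  schur u w \in C (a + b)%N /\ schur u w \notin prev_code C (a + b).

(** The [r] levels of a subspace attaining the weight lie in H^*; their positions there form a set
    [J] competing in the minimum [dstar], and [order_bound] applies to its union of Lambda^*_j. *)
Lemma gen_hamming_weight_ge m r : (r <= \dim (C m))%N ->
  (dstar X Q P r (\dim (C m)) <= gen_hamming_weight r (C m))%N.
Proof.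
move=> le_r; have [U0 U0C U0r] := subspace_of_dim le_r.
have [U [UC Ur ->]] : [set a | exists U : {vspace 'rV[k]_n},
    [/\ (U <= C m)%VS, \dim U = r & a = #|supp_space U|]]
    (gen_hamming_weight r (C m)).
  by apply: (@min_nat_mem _ #|supp_space U0|); exists U0.
set i := \dim (C m).
have iE : i = count (Hstar Q P) (iota 0 m.+1).
  by rewrite (eq_count HstarE) -dim_cap_count // capfv.
pose s := [seq a <- iota 0 m.+1 | jumps C U a].
have us : uniq s by rewrite filter_uniq // iota_uniq.
have ss : size s = r.
  by rewrite size_filter -dim_cap_count // (capv_idPl UC).
have jHs a : jumps C U a -> Hstar Q P a.
  move=> /(jumps_witness sub)[u [_ uC up]]; rewrite HstarE.
  by apply: witness_jumps uC up; rewrite memvf.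
pose idx a := count (Hstar Q P) (iota 0 a).
have mstarK a : a \in s -> mstar Q P (idx a) = a.
  by rewrite mem_filter => /andP[/jHs Ha _]; apply: mstar_count.
(* Nothing is dropped by [insub]: a level is at most [m], so its position, counted from 0, is below
   the number [i] of elements of H^* up to [m]. *)
pose t : seq 'I_i := pmap insub (map idx s).
have ut : uniq t.
  by apply/pmap_sub_uniq; rewrite map_inj_in_uniq // => a b /mstarK {2}<- /mstarK {2}<- ->.
have st : size t = r.
  rewrite size_pmap_sub -ss -(size_map idx); apply/eqP; rewrite -all_count.
  apply/allP => x /mapP[a]; rewrite mem_filter mem_iota add0n => /andP[/jHs Ha am] ->.
  by rewrite iE; apply: count_iota_lt.
pose J := [set j in t]%SET.
have cJ : #|J| = r by rewrite cardsE -st; apply/card_uniqP.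
set A := (\bigcup_(j in [set` J]) Lambda Q P j)%classic.
apply: (@leq_trans #|` fset_set A|); first by apply: min_nat_le; exists J.
(* For an infinite set [fset_set] is empty by convention, and the bound is trivial. *)
have [finA|infA] := pselect (finite_set A); last first.
  by rewrite /fset_set; case: pselect => // _; rewrite cardfs0.
apply: (order_bound sub jump mul_jump) => x.
move=> xA; have [j /= jt [Hx [b Hb xE]]] : A x by move: xA; rewrite in_fset_set // inE.
rewrite -!HstarE; split=> //.
move: jt; rewrite inE mem_pmap_sub => /mapP[a ja jE].
exists a, b; rewrite -HstarE; split=> //; last by rewrite xE jE mstarK.
by move: ja; rewrite mem_filter => /andP[].
Qed.

End WeightBound.

(** * The homogeneous coordinate ring *)

Section HomogeneousEvaluation.
Variables (N : nat).

Lemma mmap_homog (K F : fieldType) (iota : {rmorphism K -> F}) (w : F)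
    (x : 'I_N -> F) d (a : {mpoly K[N]}) :
  a \is d.-homog ->
  mmap iota (fun i => w * x i) a = w ^+ d * mmap iota x a.
Proof.
move=> /dhomogP ha; rewrite /mmap mulr_sumr !big_seq; apply: eq_bigr => m /ha md.
rewrite mulrCA; congr (_ * _); rewrite /mmap1 -md /= mdegE -prodrXr -big_split /=.
by apply: eq_bigr => i _; rewrite exprMn.
Qed.

Lemma meval_homog (K : fieldType) (c : K) (p : 'I_N -> K) d (a : {mpoly K[N]}) :
  a \is d.-homog -> a.@[fun i => c * p i] = c ^+ d * a.@[p].
Proof. exact: (@mmap_homog _ _ idfun). Qed.

Lemma map_mpoly_homog (k K : fieldType) (f : {rmorphism k -> K}) d
    (a : {mpoly k[N]}) : a \is d.-homog -> map_mpoly f a \is d.-homog.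
Proof.
move=> ha; apply/dhomogP => m.
rewrite mcoeff_msupp mcoeff_map_mpoly fmorph_eq0 -mcoeff_msupp.
exact: dhomog_mf ha _.
Qed.

End HomogeneousEvaluation.

Section CoordinateRing.
Variables (k : finFieldType) (K : closedFieldType) (toK : {rmorphism k -> K}).
Variable X : curve toK.

Local Notation N := (ambient_dim X).
Local Notation S := {mpoly K[N.+1]}.
Local Notation FR := (frac_coord_ring X).
Local Notation coord := (@Defs.coord k K toK X).

Fact coord_is_zmod_morphism : zmod_morphism coord.
Proof.
move=> a b; rewrite /Defs.coord -tofracB; congr tofrac.
by rewrite /quot_class -[RHS](@rmorphB _ _ (\pi_({ideal_quot (ideal X)}))%qT).
Qed.

Fact coord_is_monoid_morphism : monoid_morphism coord.
Proof.
split.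
  rewrite /Defs.coord -tofrac1; congr tofrac.
  by rewrite /quot_class -[RHS](@rmorph1 _ _ (\pi_({ideal_quot (ideal X)}))%qT).
move=> a b; rewrite /Defs.coord -tofracM; congr tofrac.
by rewrite /quot_class -[RHS](@rmorphM _ _ (\pi_({ideal_quot (ideal X)}))%qT).
Qed.

HB.instance Definition _ :=
  GRing.isZmodMorphism.Build S FR coord coord_is_zmod_morphism.
HB.instance Definition _ :=
  GRing.isMonoidMorphism.Build S FR coord coord_is_monoid_morphism.

Lemma coordD a b : coord (a + b) = coord a + coord b.
Proof. exact: rmorphD. Qed.

Lemma coordB a b : coord (a - b) = coord a - coord b.
Proof. exact: rmorphB. Qed.

Lemma coordM a b : coord (a * b) = coord a * coord b.
Proof. exact: rmorphM. Qed.

Lemma coordXn a e : coord (a ^+ e) = coord a ^+ e.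
Proof. exact: rmorphXn. Qed.

Lemma coord_eq0 a : (coord a == 0) = (a \in ideal X).
Proof.
rewrite /Defs.coord tofrac_eq0 -[X in X \in _]subr0 Quotient.idealrBE.
by rewrite /quot_class -(rmorph0 (\pi_({ideal_quot (ideal X)}))%qT).
Qed.

Definition const_fun (c : K) : FR := coord c%:MP.

HB.instance Definition _ :=
  GRing.RMorphism.copy const_fun (coord \o @mpolyC N.+1 K).

Lemma coord_mmap a : coord a = mmap const_fun (fun i => coord 'X_i) a.
Proof.
rewrite {1}[a]mpolyE rmorph_sum /mmap; apply: eq_bigr => m _.
rewrite -mul_mpolyC rmorphM; congr (_ * _).
by rewrite mpolyXE_id rmorph_prod; apply: eq_bigr => i _; rewrite rmorphXn.
Qed.

Lemma mmap_dehomogenize (w : FR) d a : w != 0 -> a \is d.-homog ->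
  mmap const_fun (fun i => coord 'X_i / w) a = coord a / w ^+ d.
Proof.
move=> w0 ha; have -> : (fun i => coord 'X_i / w) = (fun i => w^-1 * coord 'X_i).
  by apply/funext => i; rewrite mulrC.
by rewrite (mmap_homog _ _ _ ha) -coord_mmap exprVn mulrC.
Qed.

Lemma coord_neq0 p a : zero_locus (ideal X) p -> a.@[p] != 0 -> coord a != 0.
Proof. by move=> [_ Zp]; apply: contraNneq => /eqP; rewrite coord_eq0 => /Zp->. Qed.

(** Forms in the ideal vanish at [p]. Hence a denominator not vanishing at [p] is non-zero in the
    fraction field, and a fraction equal to 0 has value 0. *)
Lemma has_value_pmorph p : zero_locus (ideal X) p ->
  partial_morphism const_fun (@has_value _ _ _ X p).
Proof.
move=> Zp; split.
- move=> c; exists 0%N, c%:MP, 1; rewrite !mevalC rmorph1 !divr1 oner_neq0.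
  by split=> //; rewrite ?dhomog1 // -[c%:MP]mulr1 mul_mpolyC dhomogZ // dhomog1.
- move=> _ _ _ _ [d [a [b [ha hb b0 -> ->]]]] [d' [a' [b' [ha' hb' b0' -> ->]]]].
  exists (d + d')%N, (a * b' + a' * b), (b * b'); split.
  + by apply: dhomogD; [|rewrite addnC]; apply: dhomogM.
  + exact: dhomogM.
  + by rewrite mevalM mulf_neq0.
  + by rewrite rmorphD !rmorphM addf_div // (coord_neq0 Zp).
  + by rewrite mevalD !mevalM addf_div.
- move=> _ _ _ _ [d [a [b [ha hb b0 -> ->]]]] [d' [a' [b' [ha' hb' b0' -> ->]]]].
  exists (d + d')%N, (a * a'), (b * b'); split.
  + exact: dhomogM.
  + exact: dhomogM.
  + by rewrite mevalM mulf_neq0.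
  + by rewrite !rmorphM invfM mulrACA.
  + by rewrite !mevalM invfM mulrACA.
- move=> _ [d [a [b [ha hb b0 /esym/eqP x0 ->]]]]; move: x0.
  rewrite mulf_eq0 invr_eq0 (negPf (coord_neq0 Zp b0)) orbF coord_eq0.
  by move=> /(proj2 Zp)->; rewrite mul0r.
Qed.

Lemma has_valueV p x c : has_value p x c -> c != 0 -> @has_value _ _ _ X p x^-1 c^-1.
Proof.
move=> [d [a [b [ha hb b0 -> ->]]]]; rewrite mulf_eq0 negb_or => /andP[a0 _].
by exists d, b, a; rewrite !invf_div; split.
Qed.

Lemma has_value_scale p q : same_point p q ->
  @has_value _ _ _ X p = @has_value _ _ _ X q.
Proof.
suff sub p' q' x c : same_point p' q' -> has_value p' x c -> @has_value _ _ _ X q' x c.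
  move=> pq; have qp : same_point q p.
    have [c c0 qE] := pq; exists c^-1; rewrite ?invr_eq0 // => i.
    by rewrite qE mulKf.
  by apply/funext => x; apply/funext => c; apply/propext; split; apply: sub.
move=> [e e0 qE] [d [a [b [ha hb b0 -> ->]]]].
have -> : q' = (fun i => e * p' i) by apply/funext.
exists d, a, b; rewrite !(meval_homog _ _ ha) !(meval_homog _ _ hb); split=> //.
  by rewrite mulf_neq0 ?expf_neq0.
by rewrite -mulf_div divff ?expf_neq0 // mul1r.
Qed.

Definition equation s : S := map_mpoly toK (@Defs.eqn _ _ _ X s).

Lemma equation_homog s : exists d, equation s \is d.-homog.
Proof.
by have [d hs] := @eqn_homog _ _ _ X s; exists d; apply: map_mpoly_homog.
Qed.

Lemma equation_in_ideal s : equation s \in ideal X.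
Proof.
apply/idealP; exists (fun s' => (s' == s)%:R).
rewrite (bigD1 s) //= eqxx mul1r big1 ?addr0 //.
by move=> s' /negPf->; rewrite mul0r.
Qed.

Lemma same_locus p q : same_point p q -> zero_locus (ideal X) p ->
  zero_locus (ideal X) q.
Proof.
move=> [e e0 qE] [[i pi] Zp]; have qE' : q = (fun i => e * p i) by apply/funext.
split; first by exists i; rewrite qE mulf_neq0.
move=> f /idealP[c ->]; rewrite raddf_sum big1 // => s _.
rewrite [LHS]mevalM -/(equation s); have [d hs] := equation_homog s.
by rewrite qE' (meval_homog _ _ hs) Zp ?mulr0 // equation_in_ideal.
Qed.

End CoordinateRing.

(** * Taylor expansion *)

(** Euler's relation, checked on monomials; it will put each point of the curve in the kernel of its
    Jacobian matrix. *)
Lemma euler_homog (N : nat) (R : comNzRingType) d (a : {mpoly R[N]}) :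
  a \is d.-homog -> \sum_i 'X_i * a^`M(i) = a *+ d.
Proof.
move=> /dhomogP ha; under eq_bigr => i _ do rewrite {1}[a]mpolyE linear_sum /= mulr_sumr.
rewrite exchange_big [in RHS](mpolyE a) -sumrMnl /= !big_seq.
apply: eq_bigr => m hm; have /= md := ha m hm.
rewrite -md mdegE -sumrMnr; apply: eq_bigr => i _.
rewrite linearZ /= mderivX scalerA -scalerAr -mpolyXD.
have [->|m0] := eqVneq (m i) 0%N; first by rewrite mulr0 scale0r mulr0n.
by rewrite addmC submK ?lep1mP // scalerMnl mulr_natr.
Qed.

Lemma mpoly_ring_ind (N : nat) (R : nzRingType) (P : {mpoly R[N]} -> Prop) :
  (forall c, P c%:MP) -> (forall i, P 'X_i) ->
  (forall a b, P a -> P b -> P (a + b)) ->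
  (forall a b, P a -> P b -> P (a * b)) -> forall a, P a.
Proof.
move=> PC PX PD PM; apply: mpolyind => [|c m a _ _ Pa].
  by rewrite -mpolyC0; apply: PC.
apply: (PD) => //; rewrite -mul_mpolyC; apply: (PM) => //.
rewrite mpolyXE_id; apply: (big_ind P) => [|b b' Pb Pb'|i _].
- by rewrite -mpolyC1; apply: (PC).
- exact: PM.
elim: (m i) => [|e IH]; first by rewrite expr0 -mpolyC1; apply: PC.
by rewrite exprS; apply: (PM).
Qed.

Lemma row_space_le1 (F : fieldType) m n (A : 'M[F]_(m, n)) :
  (\rank A <= 1)%N -> exists l : 'rV[F]_n, (A <= l)%MS.
Proof.
case e : (\rank A) => [|[|//]] _.
  by move/eqP: e; rewrite mxrank_eq0 => /eqP->; exists 0; rewrite sub0mx.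
move: (row_base A) (eq_row_base A); rewrite e => B BA.
by exists B; rewrite BA.
Qed.

Section Taylor.
Variables (K F : fieldType) (iota : {rmorphism K -> F}).
Variables (V : F -> K -> Prop) (pV : partial_morphism iota V).
Variables (N : nat) (u : 'I_N -> F) (v : 'I_N -> K).
Hypothesis Vu : forall i, V (u i) (v i).
Let z i := u i - iota (v i).

Lemma taylor_value0 i : V (z i) 0.
Proof. by rewrite -(subrr (v i)); apply: (pmorphB pV) => //; apply: (pmorphC pV). Qed.

(** First-order expansion modulo the square of the maximal ideal, the remainder being stored as
    corrections [w] of value 0 to the partial derivatives. It holds for constants and variables and
    is stable under sums and products; in a product the cross term of the two linear parts goes into
    [w]. *)
Lemma taylor_expansion (a : {mpoly K[N]}) : exists w : 'I_N -> F,
  (forall j, V (w j) 0) /\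
  mmap iota u a = iota a.@[v] + \sum_j z j * (iota (a^`M(j)).@[v] + w j).
Proof.
elim/mpoly_ring_ind: a
  => [c|i|a b [wa [Vwa aE]] [wb [Vwb bE]]|a b [wa [Vwa aE]] [wb [Vwb bE]]].
- exists (fun _ => 0); split=> [_|]; first exact: pmorph0 pV.
  rewrite mmapC mevalC big1 ?addr0 // => j _.
  by rewrite mderivC meval0 rmorph0 addr0 mulr0.
- exists (fun _ => 0); split=> [_|]; first exact: pmorph0 pV.
  have U0 : (U_(i) - U_(i))%MM = 0%MM :> 'X_{1..N}.
    by apply/mnmP => j; rewrite mnmBE subnn mnm0E.
  rewrite mmapX mmap1U mevalXU (bigD1 i) //= mderivX mnm1E eqxx U0.
  rewrite mpolyX0 mevalZ meval1 mulr1 rmorph1 addr0 mulr1 big1 ?addr0.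
    by rewrite addrC subrK.
  by move=> j /negPf ji; rewrite mderivX mnm1E eq_sym ji scale0r meval0 rmorph0 addr0 mulr0.
- exists (fun j => wa j + wb j); split=> [j|].
    by rewrite -[0]addr0; apply: (pmorphD pV).
  rewrite mmapD aE bE mevalD rmorphD addrACA -big_split /=; congr (_ + _).
  apply: eq_bigr => j _; rewrite mderivD mevalD rmorphD; ring.
- pose A j := iota (a^`M(j)).@[v] + wa j; pose B j := iota (b^`M(j)).@[v] + wb j.
  have VB : V (\sum_l z l * B l) 0.
    have -> : 0 = \sum_(l < N) 0 * ((b^`M(l)).@[v] + 0) :> K.
      by rewrite big1 // => l _; rewrite mul0r.
    apply: (pmorph_sum pV) => l _; apply: (pmorphM pV); first exact: taylor_value0.
    by apply: (pmorphD pV) => //; apply: (pmorphC pV).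
  exists (fun j => iota a.@[v] * wb j + iota b.@[v] * wa j + A j * \sum_l z l * B l).
  split=> [j|].
    have -> : 0 = a.@[v] * 0 + b.@[v] * 0 + ((a^`M(j)).@[v] + 0) * 0 by rewrite !mulr0 !addr0.
    do ![apply: (pmorphD pV) | apply: (pmorphM pV) | apply: (pmorphC pV) | by []].
  rewrite rmorphM /= aE bE mevalM rmorphM /= -/A -/B.
  set SB := \sum_l z l * B l.
  have -> : \sum_j z j * (iota (a * b)^`M(j).@[v] +
      (iota a.@[v] * wb j + iota b.@[v] * wa j + A j * SB)) =
      \sum_j (iota a.@[v] * (z j * B j) + (iota b.@[v] + SB) * (z j * A j)).
    apply: eq_bigr => j _; rewrite mderivM mevalD !mevalM rmorphD !rmorphM /A /B.
    ring.
  rewrite big_split /= -!mulr_sumr -/SB; ring.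
Qed.

End Taylor.

(** * Uniformizers *)

Section Uniformizer.
Variables (k : finFieldType) (K : closedFieldType) (toK : {rmorphism k -> K}).
Variable X : curve toK.

Local Notation N := (ambient_dim X).
Local Notation S := {mpoly K[N.+1]}.
Local Notation FR := (frac_coord_ring X).
Local Notation coord := (@Defs.coord k K toK X).
Local Notation iota := (@const_fun k K toK X).

Variables (p : 'I_N.+1 -> K) (j0 : 'I_N.+1).
Hypotheses (Zp : zero_locus (ideal X) p) (p1 : p j0 = 1).
Local Notation V := (@has_value _ _ _ X p).
Let pV := has_value_pmorph Zp.

(** Affine coordinates [u] of the chart where the coordinate [j0] is non-zero, and their differences
    [z] with those of [p]. *)
Let x0 : FR := coord 'X_j0.
Let u i : FR := coord 'X_i / x0.
Let z i := u i - iota (p i).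

Lemma chart_neq0 : x0 != 0.
Proof. by apply: (coord_neq0 Zp); rewrite mevalXU p1 oner_neq0. Qed.

Lemma chart_value i : V (u i) (p i).
Proof.
exists 1%N, 'X_i, 'X_j0; rewrite !mevalXU p1 divr1 oner_neq0.
by split=> //; rewrite dhomogX /= mdeg1.
Qed.

Lemma chart_coord d a : a \is d.-homog -> mmap iota u a = coord a / x0 ^+ d.
Proof. exact: mmap_dehomogenize chart_neq0. Qed.

Definition jacobian : 'M[K]_(nb_eqns X, N.+1) :=
  \matrix_(s, j) ((equation s)^`M(j)).@[p].

(** The Jacobian has rank N - 1 and kills [p] by Euler's relation, whereas the unit row at [j0] does
    not, as [p j0 = 1]. Together they have rank at least N, so one further row [l] suffices to span
    everything. *)
Lemma jacobian_complement : exists l : 'rV[K]_N.+1,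
  ((1%:M : 'M_N.+1) <= col_mx jacobian (delta_mx (0 : 'I_1)%R j0) + l)%MS.
Proof.
pose e : 'rV[K]_N.+1 := delta_mx 0 j0.
have Jp : jacobian *m (\col_j p j) = 0.
  apply/matrixP => s c; rewrite !mxE.
  have [d hs] := equation_homog s.
  transitivity (\sum_i 'X_i * (equation s)^`M(i)).@[p].
    by rewrite raddf_sum; apply: eq_bigr => i _; rewrite !mxE /= mevalM mevalXU mulrC.
  by rewrite (euler_homog hs) mevalMn (proj2 Zp) ?mul0rn // equation_in_ideal.
have eNJ : ~~ (e <= jacobian)%MS.
  apply/negP => /submxP[D eD]; have : e *m (\col_j p j) = 0.
    by rewrite eD -mulmxA Jp mulmx0.
  move/matrixP/(_ 0 0); rewrite -rowE !mxE p1 => /eqP.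
  by rewrite oner_eq0.
have rk : (N <= \rank (col_mx jacobian e))%N.
  rewrite -addsmxE; have := mxrank_leqif_sup (addsmxSl jacobian e).
  rewrite addsmx_sub submx_refl /= (negPf eNJ) => /ltn_leqif.
  rewrite [\rank jacobian]nonsingular //; lia.
have [|l Cl] := @row_space_le1 _ _ _ (col_mx jacobian e)^C%MS.
  by rewrite mxrank_compl; lia.
exists l; apply: submx_trans (addsmxS (submx_refl _) Cl).
by rewrite sub1mx addsmx_compl_full.
Qed.

(* The rows of the Jacobian express combinations of the [z j] as elements of
   the square of the maximal ideal, so one linear form [t] in the [z j]
   generates it modulo its square; inverting [1 + ...] is Nakayama's lemma. *)
Lemma chart_uniformizer : exists t : FR, V t 0 /\
  forall j, exists y c, V y c /\ z j = t * y.
Proof.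
have [l /sub_addsmxP[[U W] /= UW]] := jacobian_complement.
(* Each equation vanishes at [p] and in the function field, so its expansion leaves only the linear
   terms and their corrections. *)
have /choice[w wP] : forall s, exists w : 'I_N.+1 -> FR,
    (forall j, V (w j) 0) /\
    \sum_j z j * iota (jacobian s j) = - \sum_j z j * w j.
  move=> s; have [w [Vw wE]] := taylor_expansion pV chart_value (equation s).
  have [d hs] := equation_homog s; exists w; split=> //.
  move: wE; rewrite (chart_coord hs) (proj2 Zp) ?equation_in_ideal //.
  have /eqP-> : coord (equation s) == 0 by rewrite coord_eq0 equation_in_ideal.
  rewrite mul0r rmorph0 add0r => /esym/eqP.
  under eq_bigr do rewrite mulrDr.
  rewrite big_split addr_eq0 => /eqP <-.
  by apply: eq_bigr => j _; rewrite mxE.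
pose zc : 'cV[FR]_N.+1 := \col_j z j.
pose Wm : 'M[FR]_(nb_eqns X, N.+1) := \matrix_(s, j) w s j.
pose J := map_mx iota jacobian.
have Jz : J *m zc = - (Wm *m zc).
  apply/matrixP => s c; rewrite !mxE.
  under eq_bigr do rewrite mxE [zc _ _]mxE mulrC.
  rewrite (wP s).2; congr (- _).
  by apply: eq_bigr => j _; rewrite !mxE mulrC.
(* The added unit row contributes nothing, because [z j0 = 0]. *)
have ez : map_mx iota (delta_mx 0 j0) *m zc = 0 :> 'M_(1, 1).
  rewrite map_delta_mx -rowE; apply/matrixP => a b.
  by rewrite !mxE /z /u divff ?chart_neq0 // p1 rmorph1 subrr.
pose t := (map_mx iota l *m zc) 0 0.
pose A := map_mx iota (lsubmx U) *m Wm.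
pose G := 1%:M + A.
have zE : G *m zc = t *: map_mx iota W.
  have : map_mx iota 1%:M *m zc =
      map_mx iota (U *m col_mx jacobian (delta_mx 0 j0) + W *m l) *m zc.
    by rewrite UW.
  rewrite map_mx1 mul1mx -{1}[U]hsubmxK mul_row_col map_mxD mulmxDl map_mxD mulmxDl.
  rewrite !map_mxM -!mulmxA ez mulmx0 addr0 Jz mulmxN.
  rewrite [map_mx iota l *m zc]mx11_scalar -/t mul_mx_scalar => zE.
  by rewrite mulmxDl mul1mx {1}zE addrAC -mulmxA addNr add0r.
have VA i j : V (A i j) 0.
  rewrite mxE; have -> : 0 = \sum_(s < nb_eqns X) lsubmx U i s * 0.
    by rewrite big1 // => s _; rewrite mulr0.
  apply: (pmorph_sum pV) => s _; rewrite !mxE.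
  by apply: (pmorphM pV); [apply: (pmorphC pV) | apply: (wP s).1].
have VG i j : V (G i j) (1%:M i j).
  have V1 : V ((1%:M : 'M[FR]_N.+1) i j) ((1%:M : 'M[K]_N.+1) i j).
    by rewrite -(map_mx1 iota) mxE; apply: (pmorphC pV).
  by have := pmorphD pV V1 (VA i j); rewrite addr0 [G i j]mxE.
have VdG : V (\det G) 1 by rewrite -(det1 K N.+1); apply: (pmorph_det pV).
have dG0 : \det G != 0.
  by apply: (value_unit_neq0 pV VdG); apply: oner_neq0.
exists t; split.
  rewrite /t mxE; have -> : 0 = \sum_(j < N.+1) l 0 j * 0.
    by rewrite big1 // => s _; rewrite mulr0.
  apply: (pmorph_sum pV) => j _; rewrite !mxE; apply: (pmorphM pV); first exact: (pmorphC pV).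
  by rewrite -(subrr (p j)); apply: (pmorphB pV); [apply: chart_value | apply: (pmorphC pV)].
move=> j; exists ((\det G)^-1 * (\adj G *m map_mx iota W) j 0).
exists (1^-1 * \sum_i cofactor 1%:M i j * W i 0); split.
  apply: (pmorphM pV); first by apply: has_valueV VdG (oner_neq0 _).
  rewrite mxE; apply: (pmorph_sum pV) => i _; rewrite !mxE; apply: (pmorphM pV).
    exact: (pmorph_cofactor pV).
  exact: (pmorphC pV).
apply: (mulfI dG0); rewrite mulrCA mulVKf //.
have /matrixP/(_ j 0) : \det G *: zc = t *: (\adj G *m map_mx iota W).
  by rewrite -mul_scalar_mx -mul_adj_mx -mulmxA zE -scalemxAr.
by rewrite [LHS]mxE [zc _ _]mxE => ->; rewrite [LHS]mxE.
Qed.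

(** The numerator of a function vanishing at [p] has no constant term in its expansion, so it is a
    combination of the [z j], which are multiples of [t]. *)
Lemma uniformizer_exists : exists t : FR, V t 0 /\
  forall x, V x 0 -> exists y c, V y c /\ x = t * y.
Proof.
have [t [Vt /choice[y /choice[c yP]]]] := chart_uniformizer.
exists t; split=> // _ [d [a [b [ha hb b0 -> /esym/eqP]]]].
rewrite mulf_eq0 invr_eq0 (negPf b0) orbF => /eqP a0.
have [w [Vw aE]] := taylor_expansion pV chart_value a.
rewrite a0 rmorph0 add0r (chart_coord ha) in aE.
have Vb : V (mmap iota u b)^-1 (b.@[p])^-1.
  by apply: has_valueV => //; apply: (pmorph_meval pV); apply: chart_value.
pose s := \sum_j y j * (iota (a^`M(j)).@[p] + w j).
exists (s * (mmap iota u b)^-1), ((\sum_j c j * ((a^`M(j)).@[p] + 0)) / b.@[p]).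
split.
  apply: (pmorphM pV) => //; apply: (pmorph_sum pV) => j _.
  apply: (pmorphM pV); first exact: (yP j).1.
  by apply: (pmorphD pV) => //; apply: (pmorphC pV).
have -> : coord a / coord b = mmap iota u a / mmap iota u b.
  rewrite (chart_coord ha) (chart_coord hb) invf_div mulrA divfK //.
  by rewrite expf_neq0 // chart_neq0.
rewrite (chart_coord ha) aE mulrA; congr (_ / _); rewrite mulr_sumr.
by apply: eq_bigr => j _; rewrite [in RHS]mulrA -(yP j).2.
Qed.

End Uniformizer.

(** * Algebraic dependence *)

(** The coordinates of the forms modulo [I] make a matrix with more rows than columns; a vector in
    its left kernel gives the coefficients. *)
Lemma forms_dependent (K : closedFieldType) (N : nat)
    (I : idealr {mpoly K[N.+1]}) d h (T : finType) (f : T -> {mpoly K[N.+1]}) :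
  hilbert_function I d h -> (h < #|T|)%N -> (forall t, f t \is d.-homog) ->
  exists l : T -> K, (exists t, l t != 0) /\ \sum_t l t *: f t \in I.
Proof.
move=> [B hB genB] hT hf.
have /choice[c cP] : forall t, exists c : 'rV[K]_h, f t - \sum_i c 0 i *: B i \in I.
  by move=> t; have [c [cI _]] := genB _ (hf t); exists c.
pose M := \matrix_(a < #|T|, i < h) c (enum_val a) 0 i.
have : kermx M != 0.
  rewrite -mxrank_eq0 mxrank_ker -lt0n subn_gt0.
  exact: leq_ltn_trans (rank_leq_col M) hT.
case/rowV0Pn => r /sub_kermxP rM r0.
have [a ra] : exists a, r 0 a != 0.
  apply: contrapT => h'; move/eqP: r0; apply; apply/rowP => a; rewrite mxE.
  by apply: contrapT => /eqP ra; apply: h'; exists a.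
pose l t := r 0 (enum_rank t); exists l; split.
  by exists (enum_val a); rewrite /l enum_valK.
have IZ e g : g \in I -> e *: g \in I by rewrite -mul_mpolyC; apply: idealMr.
have -> : \sum_t l t *: f t = \sum_t l t *: (f t - \sum_i c t 0 i *: B i).
  under [RHS]eq_bigr => t _ do rewrite scalerBr.
  rewrite sumrB; set s := (X in _ - X); suff -> : s = 0 by rewrite subr0.
  rewrite {}/s; under eq_bigr => t _ do rewrite scaler_sumr.
  rewrite exchange_big big1 //= => i _.
  under eq_bigr => t _ do rewrite scalerA.
  rewrite -scaler_suml; have -> : \sum_t l t * c t 0 i = (r *m M) 0 i.
    rewrite mxE (reindex (@enum_val T predT)) /=.
      by apply: eq_bigr => b _; rewrite !mxE /l enum_valK.
    by exists enum_rank => t _; rewrite ?enum_valK ?enum_rankK.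
  by rewrite rM mxE scale0r.
by apply: rpred_sum => t _; apply/IZ/cP.
Qed.

(** In degree 2Ds + e the Hilbert polynomial grows linearly in [s], while there are (s + 1)^2
    monomials of degree at most [s] in each of two variables. *)
Lemma linear_lt_square (H : {poly rat}) (D e : nat) : size H = 2%N ->
  exists s : nat, forall h : nat, H.[(2 * D * s + e)%N%:R] = h%:R ->
    (h < s.+1 * s.+1)%N.
Proof.
move=> sH; pose M := (Num.bound (`|H`_0|)%R + Num.bound (`|H`_1|)%R)%N.
(* [M] bounds the sum of the absolute values of the coefficients, so [H] is at most M(1 + m) at [m];
   for this [s] and m = 2Ds + e that is below (s + 1)^2. *)
exists (M * (1 + 2 * D + e))%N => h.
set s := (M * _)%N; set m := (2 * D * s + e)%N.
have key : (M * (1 + m) < s.+1 * s.+1)%N by rewrite /m /s; nia.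
move: s m key => s m key; rewrite (horner_coef_wide _ (eq_leq sH)).
rewrite !big_ord_recl big_ord0 /= addr0 mulr1 expr1 => hE.
suff : (h%:R <= (M * (1 + m))%N%:R :> rat).
  by rewrite ler_nat => /leq_ltn_trans; apply.
have b0 := archi_boundP (normr_ge0 H`_0).
have b1 := archi_boundP (normr_ge0 H`_1).
  have n0 : 0 <= m%:R :> rat by rewrite ler0n.
  have h1 : H`_1 * m%:R <= (Num.bound `|H`_1|)%:R * m%:R.
    by rewrite ler_wpM2r // (le_trans (ler_norm _)) // ltW.
  have h0 : H`_0 <= (Num.bound `|H`_0|)%:R by rewrite (le_trans (ler_norm _)) // ltW.
  have h2 : 0 <= (Num.bound `|H`_0|)%:R * m%:R :> rat by rewrite mulr_ge0 // ler0n.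
  have h3 : 0 <= (Num.bound `|H`_1|)%:R :> rat by rewrite ler0n.
  rewrite -hE natrM !natrD mulrDl !mulrDr !mulr1.
  by apply: lerD; [apply: (le_trans h0) | apply: (le_trans h1)];
    rewrite ?lerDl ?lerDr.
Qed.

Lemma common_denominator (F : fieldType) (a b a' b' : F) (s i j : nat) :
  b != 0 -> b' != 0 -> (i <= s)%N -> (j <= s)%N ->
  (a * b') ^+ i * (b * b') ^+ (s - i) * ((a' * b) ^+ j * (b * b') ^+ (s - j)) =
  (b * b') ^+ (s + s) * ((a' / b') ^+ j * (a / b) ^+ i).
Proof.
move=> b0 b0' le_i le_j.
have -> : a * b' = b * b' * (a / b) by field.
have -> : a' * b = b * b' * (a' / b') by field.
have E y (l : nat) : (l <= s)%N ->
    (b * b' * y) ^+ l * (b * b') ^+ (s - l) = (b * b') ^+ s * y ^+ l.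
  by move=> le_l; rewrite exprMn mulrAC -exprD subnKC.
by rewrite !E // exprD; ring.
Qed.

Section AlgebraicDependence.
Variables (k : finFieldType) (K : closedFieldType) (toK : {rmorphism k -> K}).
Variable X : curve toK.
Local Notation FR := (frac_coord_ring X).
Local Notation coord := (@Defs.coord k K toK X).
Local Notation iota := (@const_fun k K toK X).

(** The (s + 1)^2 products of powers of [x] and [t] with exponents at most [s] have the common
    denominator (b b')^(2s). Their numerators are forms of one degree, which a factor X_j^e raises
    to the range where the Hilbert polynomial is valid; for suitable [s] they outnumber the
    dimension and are dependent modulo the ideal. *)
Lemma algebraic_dependence_at p (x t : FR) c c' : zero_locus (ideal X) p ->
  has_value p x c -> has_value p t c' ->
  exists2 P : {poly {poly K}}, P != 0 &
    (map_poly (horner_eval t \o map_poly iota) P).[x] = 0.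
Proof.
move=> Zp [d [a [b [ha hb b0 xE _]]]] [d' [a' [b' [ha' hb' b0' tE _]]]].
have [[j pj] _] := Zp.
have cb0 := coord_neq0 Zp b0; have cb0' := coord_neq0 Zp b0'.
pose w : FR := coord 'X_j.
have w0 : w != 0 by apply: (coord_neq0 Zp); rewrite mevalXU.
have [H [e He] sH] := dim1 X.
have [s sP] := linear_lt_square (d + d') e sH.
have [|h hh /sP hs] := He (2 * (d + d') * s + e)%N; first exact: leq_addl.
pose T := ('I_s.+1 * 'I_s.+1)%type.
pose B := b * b'.
pose f (u : T) := (a * b') ^+ u.1 * B ^+ (s - u.1) *
  ((a' * b) ^+ u.2 * B ^+ (s - u.2)) * 'X_j ^+ e.
have hf u : f u \is (2 * (d + d') * s + e).-homog.
  have hB : B \is (d + d').-homog by apply: dhomogM.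
  have hA : a * b' \is (d + d').-homog by apply: dhomogM.
  have hA' : a' * b \is (d + d').-homog by rewrite addnC; apply: dhomogM.
  have degE D i i' : (i <= s)%N -> (i' <= s)%N ->
      (D * i + D * (s - i) + (D * i' + D * (s - i')) + 1 * e = 2 * D * s + e)%N.
    by move=> le_i le_i'; rewrite -!mulnDr !subnKC // mul1n addnn -mulnA mul2n doubleMr.
  have hX : ('X_j : {mpoly K[_]}) \is 1.-homog by rewrite dhomogX /= mdeg1.
  rewrite -(degE _ _ _ (leq_ord u.1) (leq_ord u.2)).
  exact: (dhomogM (dhomogM (dhomogM (dhomogMn _ hA) (dhomogMn _ hB))
    (dhomogM (dhomogMn _ hA') (dhomogMn _ hB))) (dhomogMn _ hX)).
have [|l [[u0 lu0] lf]] := forms_dependent hh _ hf; first by rewrite card_prod !card_ord.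
exists (\sum_(u : T) (l u *: 'X^(u.2))%:P * 'X^(u.1)).
  apply/eqP => /(congr1 (fun P : {poly {poly K}} => P`_(u0.1)`_(u0.2))).
  rewrite !coef0 coef_sum coef_sum (bigD1 u0) //= coefCM coefXn eqxx mulr1.
  rewrite coefZ coefXn eqxx mulr1 big1 ?addr0; first by move/eqP; apply/negP.
  move=> u uu0; rewrite coefCM coefXn; have [e1|] := eqVneq; last by rewrite mulr0 coef0.
  rewrite mulr1 coefZ coefXn; have [e2|] := eqVneq; last by rewrite mulr0.
  case/eqP: uu0; rewrite [u]surjective_pairing [u0]surjective_pairing.
  by congr (_, _); apply/val_inj.
pose phi := [the {rmorphism {poly K} -> FR} of horner_eval t \o map_poly iota].
have -> : (map_poly phi (\sum_(u : T) (l u *: 'X^(u.2))%:P * 'X^(u.1))).[x] =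
    \sum_(u : T) iota (l u) * t ^+ u.2 * x ^+ u.1.
  rewrite rmorph_sum horner_sum; apply: eq_bigr => u _.
  rewrite rmorphM /= map_polyC /= map_polyXn hornerM hornerC hornerXn.
  by rewrite /horner_eval map_polyZ map_polyXn hornerZ hornerXn.
have BE : coord B = coord b * coord b' := coordM b b'.
have B0 : coord B != 0 by rewrite BE; exact: mulf_neq0 cb0 cb0'.
have fE u : coord (f u) = coord B ^+ (s + s) * w ^+ e * (t ^+ u.2 * x ^+ u.1).
  have -> : coord (f u) = (coord a * coord b') ^+ u.1 * coord B ^+ (s - u.1) *
      ((coord a' * coord b) ^+ u.2 * coord B ^+ (s - u.2)) * w ^+ e.
    rewrite /f [LHS]coordM coordXn; congr (_ * _).
    rewrite [LHS]coordM; congr (_ * _).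
      by rewrite [LHS]coordM !coordXn (coordM a b').
    by rewrite [LHS]coordM !coordXn (coordM a' b).
  rewrite BE (common_denominator _ _ cb0 cb0' (leq_ord u.1) (leq_ord u.2)) -xE -tE.
  by rewrite mulrAC.
have : coord (\sum_u l u *: f u) = 0 by apply/eqP; rewrite coord_eq0.
rewrite rmorph_sum.
have -> : \sum_u coord (l u *: f u) =
    coord B ^+ (s + s) * w ^+ e * \sum_(u : T) iota (l u) * t ^+ u.2 * x ^+ u.1.
  rewrite mulr_sumr; apply: eq_bigr => u _.
  by rewrite -mul_mpolyC coordM fE mulrCA; congr (_ * _); apply: mulrA.
move/eqP; rewrite !mulf_eq0 !expf_eq0 (negPf B0) (negPf w0) !andbF /=.
by move/eqP.
Qed.

End AlgebraicDependence.

(** * Valuations on the curve *)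

Section Valuations.
Variables (k : finFieldType) (K : closedFieldType) (toK : {rmorphism k -> K}).
Variable X : curve toK.

Local Notation N := (ambient_dim X).
Local Notation S := {mpoly K[N.+1]}.
Local Notation FR := (frac_coord_ring X).
Local Notation coord := (@Defs.coord k K toK X).
Local Notation iota := (@const_fun k K toK X).

(** The function field K(X), as opposed to k(X) in [function_field]. *)
Definition geom_function (x : FR) : Prop := exists d (a b : S),
  [/\ a \is d.-homog, b \is d.-homog, b \notin ideal X & x = coord a / coord b].

Lemma geom_functionM x y : geom_function x -> geom_function y ->
  geom_function (x * y).
Proof.
move=> [d [a [b [ha hb bI ->]]]] [d' [a' [b' [ha' hb' bI' ->]]]].
exists (d + d')%N, (a * a'), (b * b'); split; try exact: dhomogM.
  by rewrite prime_idealrM negb_or bI.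
by rewrite !coordM invfM mulrACA.
Qed.

Lemma geom_functionV x : x != 0 -> geom_function x -> geom_function x^-1.
Proof.
move=> x0 [d [a [b [ha hb bI xE]]]]; exists d, b, a; split=> //.
  by apply: contraNN x0; rewrite -coord_eq0 xE => /eqP->; rewrite mul0r.
by rewrite xE invf_div.
Qed.

Lemma geom_function_const c : geom_function (iota c).
Proof.
exists 0%N, c%:MP, 1; split; rewrite ?dhomog1 //.
- by rewrite -[c%:MP]mulr1 mul_mpolyC dhomogZ // dhomog1.
- by rewrite idealr1.
- by rewrite rmorph1 divr1.
Qed.

Lemma function_field_geom x : function_field x -> geom_function x.
Proof.
move=> [d [a [b [ha hb bI xE]]]].
by exists d, (map_mpoly toK a), (map_mpoly toK b); split=> //; apply: map_mpoly_homog.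
Qed.

Lemma local_uniformizer p : zero_locus (ideal X) p ->
  exists t : FR, has_value p t 0 /\
    forall x, has_value p x 0 -> exists y c, has_value p y c /\ x = t * y.
Proof.
move=> Zp; have [[j pj] _] := Zp.
have pq : same_point p (fun i => (p j)^-1 * p i) by exists (p j)^-1; rewrite ?invr_eq0.
rewrite (has_value_scale pq).
by apply: (uniformizer_exists (j0 := j)); [apply: same_locus Zp | rewrite mulVf].
Qed.

Section LocalRing.
Variables (p : 'I_N.+1 -> K) (t : FR).
Hypothesis Zp : zero_locus (ideal X) p.
Local Notation V := (@has_value _ _ _ X p).
Hypotheses (Vt : V t 0)
  (genV : forall x, V x 0 -> exists y c, V y c /\ x = t * y).
Let pV := has_value_pmorph Zp.

(** As [t] generates the maximal ideal, sums of products of its elements collapse to multiples of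
    powers of [t]. *)
Lemma max_ideal_powP e x : max_ideal_pow p e x <-> pow_dvd V t e x.
Proof.
elim: e x => [|e IH] x /=.
  split=> [[c Vx]|[y [c [Vy ->]]]]; first exact: (@pow_dvd0 _ _ _ _ _ c).
  by exists c; rewrite mul1r.
split=> [[s [y [z [My Mz ->]]]]|[y [c [Vy ->]]]].
  elim/big_ind: _ => [||i _]; first exact: (pow_dvd_zero pV).
    by move=> ? ?; apply: (pow_dvdD pV).
  have [y' [c [Vy' ->]]] := genV (My i).
  have [z' [d [Vz' ->]]] := (IH _).1 (Mz i).
  exists (y' * z'), (c * d); split; first exact: (pmorphM pV).
  by rewrite mulrACA -exprS.
exists 1%N, (fun _ => t), (fun _ => t ^+ e * y); split=> //.
- by move=> _; apply/IH; exists y, c.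
- by rewrite big_ord1 mulrA -exprS.
Qed.

Lemma has_order_at x e : has_order p x e <-> order_at V t x e.
Proof.
rewrite -(has_orderP pV Vt genV) /has_order max_ideal_powP.
by split=> -[dx mx]; split=> // e' /max_ideal_powP; apply: mx.
Qed.

Lemma valuationE x v : is_valuation V t x v -> valuation p x = v.
Proof.
move=> vx; apply: xget_unique.
  have [y [z [e [f [xE oy oz vE]]]]] := vx.
  by exists y, z, e, f; split=> //; apply/has_order_at.
move=> w [y [z [e [f [xE /has_order_at oy /has_order_at oz wE]]]]].
by apply: (is_valuation_inj pV Vt _ vx); exists y, z, e, f.
Qed.

(** Dividing numerator and denominator by a power of a coordinate non-zero at [p] puts both in the
    local ring, where orders exist. *)
Lemma geom_function_valuation x : x != 0 -> geom_function x ->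
  is_valuation V t x (valuation p x).
Proof.
move=> x0 [d [a [b [ha hb bI xE]]]]; have [[j pj] _] := Zp.
have w0 : coord 'X_j != 0 by apply: (coord_neq0 Zp); rewrite mevalXU.
have hX : ('X_j ^+ d : S) \is d.-homog.
  by rewrite -[X in X.-homog]mul1n; apply: dhomogMn; rewrite dhomogX /= mdeg1.
have val (f : S) : f \is d.-homog ->
    V (coord f / coord 'X_j ^+ d) (f.@[p] / ('X_j ^+ d : S).@[p]).
  move=> hf; exists d, f, ('X_j ^+ d); rewrite coordXn; split=> //.
  by rewrite rmorphXn /= mevalXU expf_neq0.
have b0 : coord b != 0 by rewrite coord_eq0.
have a0 : coord a != 0 by apply: contraNneq x0 => a0; rewrite xE a0 mul0r.
have wd0 : coord 'X_j ^+ d != 0 by apply: expf_neq0; exact: w0.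
have dep y c : V y c -> exists2 P : {poly {poly K}}, P != 0 &
    (map_poly (horner_eval t \o map_poly iota) P).[y] = 0.
  by move=> Vy; apply: (algebraic_dependence_at Zp Vy Vt).
have iwd0 : (coord 'X_j ^+ d)^-1 != 0 by rewrite invr_eq0; exact: wd0.
have [v] := is_valuation_exists pV Vt genV dep (mulf_neq0 a0 iwd0)
  (mulf_neq0 b0 iwd0) (val _ ha) (val _ hb).
rewrite invf_div mulrA (divfK wd0) -xE => vx.
by rewrite (valuationE vx).
Qed.

End LocalRing.

Variables (p : 'I_N.+1 -> K).
Hypothesis Zp : zero_locus (ideal X) p.
Let pV := has_value_pmorph Zp.

Let dependence t : has_value p t 0 -> forall x c, has_value p x c ->
  exists2 P : {poly {poly K}}, P != 0 &
    (map_poly (horner_eval t \o map_poly iota) P).[x] = 0.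
Proof. by move=> Vt x c Vx; apply: algebraic_dependence_at Zp Vx Vt. Qed.

Lemma valuationM x y : x != 0 -> y != 0 -> geom_function x -> geom_function y ->
  valuation p (x * y) = valuation p x + valuation p y.
Proof.
move=> x0 y0 gx gy; have [t [Vt genV]] := local_uniformizer Zp.
apply: (valuationE Zp Vt genV).
by apply: (is_valuationM pV); apply: geom_function_valuation.
Qed.

Lemma valuationV x : x != 0 -> geom_function x ->
  valuation p x^-1 = - valuation p x.
Proof.
move=> x0 gx; have [t [Vt genV]] := local_uniformizer Zp.
apply: (valuationE Zp Vt genV).
by apply: is_valuationV; apply: geom_function_valuation.
Qed.

Lemma valuationD x y b : x != 0 -> y != 0 -> x + y != 0 ->
  geom_function x -> geom_function y ->
  b <= valuation p x -> b <= valuation p y -> b <= valuation p (x + y).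
Proof.
move=> x0 y0 xy0 gx gy bx by_; have [t [Vt genV]] := local_uniformizer Zp.
have vx := geom_function_valuation Zp Vt genV x0 gx.
have vy := geom_function_valuation Zp Vt genV y0 gy.
have [c vc bc] := is_valuationD pV Vt genV (dependence Vt) vx vy xy0 bx by_.
by rewrite (valuationE Zp Vt genV vc).
Qed.

Lemma valuation_ge0_regular x : x != 0 -> geom_function x ->
  0 <= valuation p x -> exists c, has_value p x c.
Proof.
move=> x0 gx; have [t [Vt genV]] := local_uniformizer Zp.
have vx := geom_function_valuation Zp Vt genV x0 gx.
by apply: (is_valuation_ge0 pV _ Vt vx) => y c; apply: has_valueV.
Qed.

Lemma regular_valuation x c : x != 0 -> geom_function x -> has_value p x c ->
  0 <= valuation p x /\ (c == 0) = (0 < valuation p x).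
Proof.
move=> x0 gx Vx; have [t [Vt genV]] := local_uniformizer Zp.
have vx := geom_function_valuation Zp Vt genV x0 gx.
exact: (value_valuation pV Vt genV (dependence Vt) Vx vx).
Qed.

End Valuations.

Lemma valuation_scale (k : finFieldType) (K : closedFieldType)
    (toK : {rmorphism k -> K}) (X : curve toK) (p q : 'I_(ambient_dim X).+1 -> K)
    (x : frac_coord_ring X) :
  same_point p q -> valuation p x = valuation q x.
Proof.
move=> pq; have hv := has_value_scale pq.
have hm : @max_ideal_pow _ _ _ X p = max_ideal_pow q.
  by apply/funext; elim=> [|e IH]; rewrite /= /local_ring /max_ideal ?IH hv.
by rewrite /valuation /has_order hm.
Qed.

(** Transitivity is asked only through a middle term in [P]: ratios of coordinates can be chained
    only over a non-zero coordinate. *)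
Lemma total_preorder_max (T : eqType) (P : pred T) (R : T -> T -> Prop)
    (s : seq T) x0 :
  P x0 -> all P s ->
  (forall x y z, P y -> R x y -> R y z -> R x z) ->
  (forall x y, P x -> P y -> R x y \/ R y x) ->
  exists2 m, P m & forall x, x \in x0 :: s -> R x m.
Proof.
move=> P0 Ps trR totR; have refl x : P x -> R x x by move=> Px; case: (totR x x).
elim: s x0 P0 Ps => [|y s IH] x0 P0 /= => [_|/andP[Py Ps]].
  by exists x0 => // x; rewrite inE => /eqP->; apply: refl.
have [m Pm mP] := IH y Py Ps; have [R0|R0] := totR x0 m P0 Pm.
  by exists m => // x; rewrite inE => /orP[/eqP->//|/mP].
exists x0 => // x; rewrite inE => /orP[/eqP->|/mP Rxm]; first exact: refl.
exact: trR Pm Rxm R0.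
Qed.

(** * Centres of places and functions without poles *)

Section GlobalRegular.
Variables (k : finFieldType) (K : closedFieldType) (toK : {rmorphism k -> K}).
Variable X : curve toK.

Local Notation N := (ambient_dim X).
Local Notation FR := (frac_coord_ring X).
Local Notation coord := (@Defs.coord k K toK X).
Local Notation iota := (@const_fun k K toK X).

(* Valuative criterion of properness: a maximal place is finite on the ratios
   of all coordinates to one of them, hence centred at a point of the curve. *)
Lemma place_center (V : FR -> K -> Prop) p0 : zero_locus (ideal X) p0 ->
  maximal_pmorph iota V ->
  exists2 p, zero_locus (ideal X) p &
    forall x c, has_value p x c -> V x c.
Proof.
move=> [[j1 pj1] Zp0] maxV; have pV := maxV.1.
pose P (j : 'I_N.+1) := coord 'X_j != 0.
have P1 : P j1.
  by rewrite /P coord_eq0; apply: contraNN pj1 => /Zp0; rewrite mevalXU => ->.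
have [||j0 w0 j0P] := @total_preorder_max _ P (fun i j =>
  exists c, V (coord 'X_i / coord 'X_j) c) _ j1 P1 (filter_all P (enum 'I_N.+1)).
- move=> x y z y0 [c Vc] [d Vd]; exists (c * d).
  by have := pmorphM pV Vc Vd; rewrite mulrA (divfK y0).
- move=> x y Px Py.
  have xy0 : coord 'X_x / coord 'X_y != 0.
    by apply: mulf_neq0; [exact: Px | rewrite invr_eq0; exact: Py].
  have [[c Vc]|[c Vc]] := maximal_pmorph_total maxV xy0.
    by left; exists c.
  by right; exists c; rewrite -invf_div.
have /choice[p pP] : forall i, exists c, V (coord 'X_i / coord 'X_j0) c.
  move=> i; have [Pi|] := boolP (P i).
    by apply: j0P; rewrite inE mem_filter Pi mem_enum orbT.
  by rewrite negbK => /eqP->; exists 0; rewrite mul0r; apply: pmorph0 pV.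
have val d a : a \is d.-homog -> V (coord a / coord 'X_j0 ^+ d) a.@[p].
  by move=> ha; rewrite -(mmap_dehomogenize w0 ha); apply: (pmorph_meval pV).
have p1 : p j0 = 1.
  apply: (pmorph_inj pV (pP j0)); rewrite (divff w0); apply: pmorph1 pV.
exists p.
  split; first by exists j0; rewrite p1 oner_neq0.
  move=> f /idealP[c ->]; rewrite raddf_sum big1 // => s' _.
  rewrite [LHS]mevalM -/(equation s'); have [d hs] := equation_homog s'.
  rewrite (pmorph0_inj pV (_ : V 0 (equation s').@[p])) ?mulr0 //.
  have := val _ _ hs; have /eqP-> : coord (equation s') == 0.
    by rewrite coord_eq0 equation_in_ideal.
  by rewrite mul0r.
move=> _ _ [d [a [b [ha hb b0 -> ->]]]].
have -> : coord a / coord b =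
    coord a / coord 'X_j0 ^+ d * (coord b / coord 'X_j0 ^+ d)^-1.
  by rewrite invf_div mulrA (divfK (expf_neq0 d w0)).
apply: (pmorphM pV); first exact: val.
by apply: (maximal_pmorphV maxV) => //; apply: val.
Qed.

Lemma regular_constant (x : FR) p0 : zero_locus (ideal X) p0 ->
  (forall p, zero_locus (ideal X) p -> exists c, has_value p x c) ->
  exists c, x = iota c.
Proof.
move=> Zp0 regx; apply: contrapT => nc.
have xK c : x != iota c by apply/eqP => xE; apply: nc; exists c.
have x0 : x != 0 by have := xK 0; rewrite rmorph0.
have [|V maxV V0] := @exists_place K FR iota x^-1.
  move=> c; apply/eqP => xE; have := xK c^-1.
  by rewrite fmorphV -xE invrK eqxx.
have [p Zp sub] := place_center Zp0 maxV.
have [c /sub Vx] := regx _ Zp.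
have := pmorphM maxV.1 Vx V0; rewrite divff // mulr0.
by move=> /(pmorph_inj maxV.1 (pmorph1 maxV.1))/eqP; rewrite oner_eq0.
Qed.

End GlobalRegular.

(** * Descent to the ground field *)

(** A maximal [k]-subspace [W] of [K] avoiding 1 is a complement of the image of [k]; the retraction
    is the projection along [W]. *)
Lemma linear_retraction (k K : fieldType) (toK : {rmorphism k -> K}) :
  exists l : {additive K -> k},
    (forall x a, l (x * toK a) = l x * a) /\ l 1 = 1.
Proof.
pose P (W : set K) := (forall a x y, W x -> W y -> W (x * toK a + y)) /\ ~ W 1.
have [C CP totC|W [[WD W1] maxW]] := @Zorn_bigcup K P.
  split=> [a x y [A CA Ax] [B CB By]|[A /CP[_]//]].
  by case: (totC _ _ CA CB) => sub; [exists B|exists A] => //;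
    apply: (CP _ _).1 => //; apply: sub.
(* The empty set satisfies [P] vacuously, so 0 is in [W] only by maximality. *)
have W0 : W 0.
  apply: contrapT => nW0; have nW x : ~ W x.
    by move=> Wx; apply: nW0; have := WD (-1) _ _ Wx Wx; rewrite rmorphN1 mulrN1 addNr.
  apply: (maxW [set 0]).
    by split=> [x /nW//|sub]; apply/nW0/sub.
  split=> [a x y -> ->|/eqP]; first by rewrite mul0r addr0.
  by rewrite oner_eq0.
have WZ a x : W x -> W (x * toK a).
  by move=> Wx; have := WD a _ _ Wx W0; rewrite addr0.
have WA x y : W x -> W y -> W (x + y).
  by move=> Wx Wy; have := WD 1 _ _ Wx Wy; rewrite rmorph1 mulr1.
have /choice[l lP] : forall x, exists a, W (x - toK a).
  move=> x; have [Wx|nWx] := pselect (W x); first by exists 0; rewrite rmorph0 subr0.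
  (* If [x] is not in [W], the larger subspace spanned by [W] and [x] must contain 1, which
     expresses [x] modulo [W] as a scalar. *)
  pose W' := [set y | exists a w, W w /\ y = x * toK a + w].
  have [[a [w [Ww E1]]]|nW'1] := pselect (W' 1).
    have a0 : a != 0.
      by apply/eqP => a0; apply: W1; rewrite E1 a0 rmorph0 mulr0 add0r.
    exists a^-1; have -> : x - toK a^-1 = w * toK (- a^-1).
      rewrite rmorphN fmorphV -[X in _ - X]mul1r E1 mulrDl mulfK ?fmorph_eq0 //.
      by rewrite opprD addNKr mulrN.
    exact: WZ.
  case: (maxW W').
    split=> [y Wy|sub]; first by exists 0, y; rewrite rmorph0 mulr0 add0r.
    apply/nWx/sub; exists 1, 0.
    by rewrite rmorph1 mulr1 addr0.
  split=> // a y z [b [w [Ww ->]]] [c [w' [Ww' ->]]].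
  exists (b * a + c), (w * toK a + w'); split; first exact: WD.
  by rewrite rmorphD rmorphM; ring.
have l_uniq x a : W (x - toK a) -> l x = a.
  move=> Wa; apply/eqP; rewrite -subr_eq0; apply/negP => /negP d0; apply: W1.
  have : W (toK (a - l x)).
    have := WA _ _ (lP x) (WZ (-1) _ Wa).
    rewrite rmorphN1 mulrN1 opprB addrC addrA subrK.
    by rewrite rmorphB.
  by move/(WZ (a - l x)^-1); rewrite -rmorphM divff ?rmorph1 // -opprB oppr_eq0.
have lD : zmod_morphism l.
  move=> x y; apply: l_uniq.
  have := WA _ _ (lP x) (WZ (-1) _ (lP y)).
  by rewrite rmorphN1 mulrN1 rmorphB; congr W; ring.
pose la : {additive K -> k} := HB.pack l (GRing.isZmodMorphism.Build K k l lD).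
exists la; split=> [x a|]; last by apply: l_uniq; rewrite rmorph1 subrr.
by apply: l_uniq; have := WZ a _ (lP x); rewrite mulrBl -rmorphM.
Qed.

Section Descent.
Variables (k K : fieldType) (toK : {rmorphism k -> K}) (N : nat).
Variable l : {additive K -> k}.
Hypothesis lZ : forall x a, l (x * toK a) = l x * a.

Lemma map_mpoly_retract (f : {mpoly K[N]}) (g : {mpoly k[N]}) :
  map_mpoly l (f * map_mpoly toK g) = map_mpoly l f * g.
Proof.
apply/mpolyP => m; rewrite mcoeff_map_mpoly !mcoeffM raddf_sum.
by apply: eq_bigr => i _; rewrite !mcoeff_map_mpoly lZ.
Qed.

Lemma meval_map_rmorph (g : {mpoly k[N]}) (q : 'I_N -> k) :
  (map_mpoly toK g).@[fun i => toK (q i)] = toK g.@[q].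
Proof.
elim/mpoly_ring_ind: g => [c|i|a b IHa IHb|a b IHa IHb].
- by rewrite map_mpolyC !mevalC.
- by rewrite map_mpolyX !mevalXU.
- by rewrite rmorphD !mevalD rmorphD IHa IHb.
- by rewrite rmorphM !mevalM rmorphM IHa IHb.
Qed.

Lemma meval_map_retract (f : {mpoly K[N]}) (q : 'I_N -> k) :
  (map_mpoly l f).@[q] = l f.@[fun i => toK (q i)].
Proof.
elim/mpolyind: f => [|c m f _ _ IH]; first by rewrite !raddf0.
have -> : c *: 'X_[m] = c%:MP * map_mpoly toK 'X_[m] by rewrite map_mpolyX mul_mpolyC.
rewrite raddfD !mevalD raddfD /= IH; congr (_ + _).
by rewrite map_mpoly_retract map_mpolyC !mevalM !mevalC meval_map_rmorph lZ.
Qed.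

End Descent.

(** * The function field over the ground field *)

Section RationalFunctions.
Variables (k : finFieldType) (K : closedFieldType) (toK : {rmorphism k -> K}).
Variable X : curve toK.

Local Notation N := (ambient_dim X).
Local Notation FR := (frac_coord_ring X).
Local Notation coord := (@Defs.coord k K toK X).
Local Notation iota := (@const_fun k K toK X).
Local Notation geom := (@Defs.geom k K toK X).

Lemma function_fieldM (x y : FR) : function_field x -> function_field y ->
  function_field (x * y).
Proof.
move=> [d [a [b [ha hb bI ->]]]] [d' [a' [b' [ha' hb' bI' ->]]]].
exists (d + d')%N, (a * a'), (b * b'); rewrite ![map_mpoly toK (_ * _)]rmorphM /=.
split; try exact: dhomogM.
  by rewrite prime_idealrM negb_or bI.
by rewrite !coordM invfM mulrACA.
Qed.

Lemma function_fieldD (x y : FR) : function_field x -> function_field y ->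
  function_field (x + y).
Proof.
move=> [d [a [b [ha hb bI ->]]]] [d' [a' [b' [ha' hb' bI' ->]]]].
exists (d + d')%N, (a * b' + a' * b), (b * b').
rewrite [map_mpoly toK (_ + _)]rmorphD /= [map_mpoly toK (a * _)]rmorphM.
rewrite [map_mpoly toK (a' * _)]rmorphM [map_mpoly toK (b * _)]rmorphM /=; split.
- by apply: dhomogD; [|rewrite addnC]; apply: dhomogM.
- exact: dhomogM.
- by rewrite prime_idealrM negb_or bI.
- by rewrite addf_div ?coord_eq0 // coordD !coordM.
Qed.

Lemma function_fieldV (x : FR) : x != 0 -> function_field x ->
  function_field x^-1.
Proof.
move=> x0 [d [a [b [ha hb bI xE]]]]; exists d, b, a; split=> //.
  by apply: contraNN x0; rewrite -coord_eq0 xE => /eqP->; rewrite mul0r.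
by rewrite xE invf_div.
Qed.

Lemma function_field_const c : function_field (iota (toK c)).
Proof.
exists 0%N, c%:MP, 1; rewrite rmorph1 map_mpolyC; split; rewrite ?dhomog1 //.
- by rewrite -[c%:MP]mulr1 mul_mpolyC dhomogZ // dhomog1.
- by rewrite idealr1.
- by rewrite rmorph1 divr1.
Qed.

(* The numerator and denominator of a fraction over [K] solve a linear system
   over [k]; applying a [k]-linear retraction of [K] to their coefficients
   gives a solution over [k], with the same denominator at the point. *)
Lemma rational_value (Q : 'I_N.+1 -> k) (x : FR) c : rational_point X Q ->
  function_field x -> has_value (geom Q) x c -> exists c0, c = toK c0.
Proof.
move=> ZQ [d [A [B [hA hB BI xE]]]] Vx.
have pV := has_value_pmorph ZQ.
have [d' [a [b [ha hb b0 xE' cE]]]] := Vx.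
have [l [lZ l1]] := linear_retraction toK.
(* The denominator now takes the value 1 at [Q], and so does its image under the retraction, which
   fixes 1. *)
pose b' := (b.@[geom Q])^-1 *: b; pose a' := (b.@[geom Q])^-1 *: a.
have b'1 : b'.@[geom Q] = 1 by rewrite mevalZ mulVf.
have cE' : c = a'.@[geom Q] by rewrite mevalZ cE mulrC.
have : a' * map_mpoly toK B - b' * map_mpoly toK A \in ideal X.
  rewrite /a' /b' -!scalerAl -scalerBr -mul_mpolyC; apply: idealMr.
  rewrite -coord_eq0 rmorphB /= !coordM subr_eq0 [coord b * _]mulrC.
  rewrite -(eqr_div _ _ (coord_neq0 ZQ b0)) ?coord_eq0 //.
  by rewrite -xE' -xE.
move=> /idealP[e eE].
have lE : map_mpoly l a' * B - map_mpoly l b' * A =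
    \sum_s map_mpoly l (e s) * @Defs.eqn _ _ _ X s.
  rewrite -!(map_mpoly_retract lZ) -raddfB eE raddf_sum.
  by apply: eq_bigr => s _; apply: map_mpoly_retract.
have lI : map_mpoly toK (map_mpoly l a' * B - map_mpoly l b' * A) \in ideal X.
  apply/idealP; exists (fun s => map_mpoly toK (map_mpoly l (e s))).
  by rewrite lE raddf_sum; apply: eq_bigr => s _; apply: rmorphM.
exists (map_mpoly l a').@[Q].
have hom (f : {mpoly K[N.+1]}) : f \is d'.-homog ->
    map_mpoly toK (map_mpoly l f) \is d'.-homog.
  move=> hf; apply/dhomogP => m; rewrite mcoeff_msupp !mcoeff_map_mpoly fmorph_eq0.
  apply: contraNeq => md; rewrite (dhomog_nemf_coeff hf) ?raddf0 //.
have lb1 : (map_mpoly toK (map_mpoly l b')).@[geom Q] = 1.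
  by rewrite meval_map_rmorph (meval_map_retract lZ) [X in l X]b'1 l1 rmorph1.
apply: (pmorph_inj pV Vx).
exists d', (map_mpoly toK (map_mpoly l a')), (map_mpoly toK (map_mpoly l b')).
rewrite lb1 divr1 oner_neq0 meval_map_rmorph; split=> //.
- by apply: hom; apply: dhomogZ.
- by apply: hom; apply: dhomogZ.
have cb : coord (map_mpoly toK (map_mpoly l b')) != 0.
  by apply: (coord_neq0 ZQ); rewrite lb1 oner_neq0.
have cB : coord (map_mpoly toK B) != 0 by rewrite coord_eq0.
rewrite xE; apply/eqP; rewrite (eqr_div _ _ cB cb) [X in X == _]mulrC eq_sym.
rewrite -!coordM -subr_eq0 -coordB coord_eq0.
by rewrite -!rmorphM -rmorphB.
Qed.

End RationalFunctions.

(** * The spaces L(zQ) and the codes C(D, mQ) *)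

Section OnePointSpaces.
Variables (k : finFieldType) (K : closedFieldType) (toK : {rmorphism k -> K}).
Variable X : curve toK.

Local Notation N := (ambient_dim X).
Local Notation FR := (frac_coord_ring X).
Local Notation iota := (@const_fun k K toK X).
Local Notation geom := (@Defs.geom k K toK X).

Variable Q : 'I_N.+1 -> k.
Hypothesis ratQ : rational_point X Q.
Local Notation vQ := (@valuation _ _ _ X (geom Q)).

(* [one_point_space z] is L(z Q); the integer z = -1 is needed for L(-Q) = 0. *)
Definition one_point_space (z : int) (x : FR) : Prop :=
  function_field x /\
  (x = 0 \/ (- z <= vQ x /\ forall p, zero_locus (ideal X) p ->
     ~ same_point (geom Q) p -> 0 <= valuation p x)).

Lemma one_point_spaceE (m : nat) (x : FR) :
  riemann_roch_space (@mult_point _ _ _ X m Q) x <-> one_point_space m%:Z x.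
Proof.
rewrite /riemann_roch_space /one_point_space /mult_point.
have refl : same_point (geom Q) (geom Q).
  by exists 1; rewrite ?oner_neq0 // => i; rewrite mul1r.
split=> -[fx [x0|vx]]; split=> //; do ?by left.
  right; split=> [|p Zp npQ].
    by have := vx _ ratQ; rewrite asboolT.
  by have := vx _ Zp; rewrite asboolF // oppr0.
right=> p Zp; case: asboolP => [pQ|npQ]; last by rewrite oppr0; apply: vx.2.
by rewrite -(valuation_scale x pQ); apply: vx.1.
Qed.

Lemma one_point_space_le z z' x : z <= z' -> one_point_space z x ->
  one_point_space z' x.
Proof.
move=> le [fx [x0|[vx vp]]]; split=> //; [by left | right; split=> //].
by apply: le_trans vx; rewrite lerN2.
Qed.

Lemma one_point_space0 z : one_point_space z 0.
Proof.
split; last by left.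
by have := @function_field_const _ _ _ X 0; rewrite !rmorph0.
Qed.

Lemma one_point_spaceD z x y : one_point_space z x -> one_point_space z y ->
  one_point_space z (x + y).
Proof.
move=> [fx [->|[vx vpx]]] [fy [->|[vy vpy]]]; rewrite ?addr0 ?add0r.
- exact: one_point_space0.
- by split=> //; right.
- by split=> //; right.
have [x0|x0] := pselect (x = 0).
  by rewrite x0 add0r; split=> //; right.
have [y0|y0] := pselect (y = 0).
  by rewrite y0 addr0; split=> //; right.
split; first exact: function_fieldD.
have [xy0|xy0] := pselect (x + y = 0); [by left | right].
move/eqP: x0 => x0; move/eqP: y0 => y0; move/eqP: xy0 => xy0.
have gx := function_field_geom fx; have gy := function_field_geom fy.
split; first exact: (valuationD ratQ x0 y0 xy0).
move=> p Zp npQ; apply: (valuationD Zp x0 y0 xy0) => //.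
  exact: vpx.
exact: vpy.
Qed.

Lemma one_point_spaceM z z' x y : one_point_space z x -> one_point_space z' y ->
  one_point_space (z + z') (x * y).
Proof.
move=> [fx [->|[vx vpx]]] [fy [->|[vy vpy]]]; rewrite ?mulr0 ?mul0r;
  do ?exact: one_point_space0.
have [->|x0] := pselect (x = 0); first by rewrite mul0r; apply: one_point_space0.
have [->|y0] := pselect (y = 0); first by rewrite mulr0; apply: one_point_space0.
move/eqP: x0 => x0; move/eqP: y0 => y0.
have gx := function_field_geom fx; have gy := function_field_geom fy.
split; [exact: function_fieldM | right; split].
  by rewrite (valuationM ratQ x0 y0 gx gy) opprD; apply: lerD.
move=> p Zp npQ; rewrite (valuationM Zp x0 y0 gx gy).
by apply: addr_ge0; [apply: vpx | apply: vpy].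
Qed.

Lemma const_value p c : zero_locus (ideal X) p -> has_value p (iota c) c.
Proof. by move=> Zp; apply: pmorphC (has_value_pmorph Zp) c. Qed.

Lemma valuation_const p c : zero_locus (ideal X) p -> c != 0 ->
  valuation p (iota c) = 0.
Proof.
move=> Zp c0; have ic0 : iota c != 0 by rewrite fmorph_eq0.
have [v0 vE] := regular_valuation Zp ic0 (geom_function_const X c) (const_value c Zp).
by apply/eqP; rewrite eq_le v0 andbT leNgt -vE.
Qed.

Lemma one_point_space_const a : one_point_space 0 (iota (toK a)).
Proof.
have [->|a0] := eqVneq a 0; first by rewrite !rmorph0; apply: one_point_space0.
split; [exact: function_field_const | right; split=> [|p Zp _]].
  by rewrite valuation_const ?fmorph_eq0.
by rewrite valuation_const ?fmorph_eq0.
Qed.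

Lemma one_point_spaceZ z a x : one_point_space z x ->
  one_point_space z (iota (toK a) * x).
Proof.
by move=> Lx; rewrite -[z]add0r; apply: one_point_spaceM (one_point_space_const a) Lx.
Qed.

(** Such a function is regular at every point, hence constant, and its positive valuation at [Q]
    excludes non-zero constants. *)
Lemma one_point_spaceN1 x : one_point_space (-1) x -> x = 0.
Proof.
move=> [fx [//|[vx vpx]]]; apply: contrapT => /eqP x0.
have gx := function_field_geom fx; rewrite opprK in vx.
have [|c xE] := @regular_constant _ _ _ X x _ ratQ.
  move=> p Zp; apply: (valuation_ge0_regular Zp x0 gx).
  have [pQ|] := pselect (same_point (geom Q) p); last exact: vpx.
  by rewrite -(valuation_scale x pQ); apply: le_trans vx.
have c0 : c != 0 by apply: contraNneq x0 => c0; rewrite xE c0 rmorph0.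
by move: vx; rewrite xE (valuation_const ratQ c0).
Qed.

Lemma one_point_space_exact z x : one_point_space z x ->
  ~ one_point_space (z - 1) x -> x != 0 /\ vQ x = - z.
Proof.
move=> Lx nLx; have x0 : x != 0.
  by apply/eqP => x0; apply: nLx; rewrite x0; apply: one_point_space0.
split=> //; have [fx [/eqP|[vx vpx]]] := Lx; first by rewrite (negPf x0).
apply/eqP; rewrite eq_le vx andbT; rewrite leNgt; apply/negP => lt.
by apply: nLx; split=> //; right; split=> //; lia.
Qed.

Lemma one_point_spaceM_exact z z' x y :
  one_point_space z x -> ~ one_point_space (z - 1) x ->
  one_point_space z' y -> ~ one_point_space (z' - 1) y ->
  ~ one_point_space (z + z' - 1) (x * y).
Proof.
move=> Lx nLx Ly nLy.
have [x0 vx] := one_point_space_exact Lx nLx.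
have [y0 vy] := one_point_space_exact Ly nLy.
have gx := function_field_geom Lx.1; have gy := function_field_geom Ly.1.
move=> [_ [/eqP|[vxy _]]]; first by rewrite mulf_eq0 (negPf x0) (negPf y0).
by move: vxy; rewrite (valuationM ratQ x0 y0 gx gy) vx vy; lia.
Qed.

(** If [y] also has pole order exactly [z], then [y / x] is a unit at [Q]; its value there lies in
    [k] because [Q] is rational. Subtracting that multiple of [x] from [y] lowers the pole order. *)
Lemma one_point_space_jump z x y :
  one_point_space z x -> ~ one_point_space (z - 1) x -> one_point_space z y ->
  exists a, one_point_space (z - 1) (y - iota (toK a) * x).
Proof.
move=> Lx nLx Ly; have [x0 vx] := one_point_space_exact Lx nLx.
have [Ly1|nLy1] := pselect (one_point_space (z - 1) y).
  by exists 0; rewrite !rmorph0 mul0r subr0.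
have [y0 vy] := one_point_space_exact Ly nLy1.
have gx := function_field_geom Lx.1; have gy := function_field_geom Ly.1.
have gx' := geom_functionV x0 gx; have x'0 := invr_neq0 x0.
have w0 : y / x != 0 := mulf_neq0 y0 x'0.
have gw : geom_function (y / x) := geom_functionM gy gx'.
have vw : vQ (y / x) = 0.
  by rewrite (valuationM ratQ y0 x'0 gy gx') (valuationV ratQ x0 gx) vx vy subrr.
have [|c Vc] := valuation_ge0_regular ratQ w0 gw; first by rewrite vw.
have fw : function_field (y / x) := function_fieldM Ly.1 (function_fieldV x0 Lx.1).
have [a cE] := rational_value ratQ fw Vc.
exists a; have Lr : one_point_space z (y - iota (toK a) * x).
  rewrite -mulNr -[- iota _]rmorphN -rmorphN.
  exact: one_point_spaceD Ly (one_point_spaceZ (- a) Lx).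
have [->|/eqP r0] := pselect (y - iota (toK a) * x = 0).
  exact: one_point_space0.
have [fr [/eqP|[vr vpr]]] := Lr; first by rewrite (negPf r0).
split=> //; right; split=> //.
have gr := function_field_geom fr.
have rx0 : (y - iota (toK a) * x) / x != 0 := mulf_neq0 r0 x'0.
have grx : geom_function ((y - iota (toK a) * x) / x) := geom_functionM gr gx'.
have Vrx : has_value (geom Q) ((y - iota (toK a) * x) / x) 0.
  rewrite mulrBl (mulfK x0) -(subrr c).
  apply: (pmorphB (has_value_pmorph ratQ) Vc).
  by rewrite cE; apply: const_value.
have [_] := regular_valuation ratQ rx0 grx Vrx; rewrite eqxx => /esym.
rewrite (valuationM ratQ r0 x'0 gr gx') (valuationV ratQ x0 gx) vx; lia.
Qed.

End OnePointSpaces.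

(** * One-point codes as a filtration of the space of words *)

Section OnePointCodes.
Variables (k : finFieldType) (K : closedFieldType) (toK : {rmorphism k -> K}).
Variable X : curve toK.

Local Notation N := (ambient_dim X).
Local Notation iota := (@const_fun k K toK X).
Local Notation geom := (@Defs.geom k K toK X).

Variables (n : nat) (Q : 'I_N.+1 -> k) (P : 'I_n -> 'I_N.+1 -> k).
Hypotheses (ratQ : rational_point X Q) (ratP : forall j, rational_point X (P j)).
Local Notation C := (code X Q P).

Definition evaluation_of (z : int) (v : 'rV[k]_n) : Prop :=
  exists2 x, one_point_space Q z x &
    forall j, has_value (geom (P j)) x (toK (v 0 j)).

Lemma evaluation_of_lin z a v w : evaluation_of z v -> evaluation_of z w ->
  evaluation_of z (a *: v + w).
Proof.
move=> [x Lx Vx] [y Ly Vy]; exists (iota (toK a) * x + y).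
  exact: one_point_spaceD (one_point_spaceZ ratQ a Lx) Ly.
move=> j; have pV := has_value_pmorph (ratP j).
rewrite !mxE rmorphD rmorphM; apply: (pmorphD pV) => //; apply: (pmorphM pV) => //.
exact: (pmorphC pV).
Qed.

Lemma evaluation_of0 z : evaluation_of z 0.
Proof.
exists 0; first exact: one_point_space0.
by move=> j; rewrite mxE rmorph0; apply: pmorph0 (has_value_pmorph (ratP j)).
Qed.

(** Evaluations are closed under linear combinations, so taking the span of [codewords] adds
    nothing. *)
Lemma mem_code m v : v \in C m <-> evaluation_of m%:Z v.
Proof.
have codewordP w : w \in enum (codewords Q P m) <-> evaluation_of m%:Z w.
  rewrite mem_enum inE; split=> [/asboolP[x /(one_point_spaceE ratQ) Lx Vx]|[x Lx Vx]].
    by exists x.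
  by apply/asboolP; exists x => //; apply/(one_point_spaceE ratQ).
split; last by move=> /codewordP; apply: memv_span.
move=> vC; rewrite (coord_span (X := in_tuple _) vC).
apply: big_ind => [|u w Eu Ew|i _]; first exact: evaluation_of0.
  by rewrite -[u]scale1r; apply: evaluation_of_lin.
rewrite -[X in evaluation_of _ X]addr0; apply: evaluation_of_lin.
  by apply/codewordP/mem_nth; rewrite ltn_ord.
exact: evaluation_of0.
Qed.

(** For [m = 0] this rests on L(-Q) = 0. *)
Lemma mem_prev_code m v : v \in prev_code C m <-> evaluation_of (m%:Z - 1) v.
Proof.
case: m => [|m].
  rewrite memv0; split=> [/eqP->|[x /(one_point_spaceN1 ratQ) -> V0]].
    exact: evaluation_of0.
  apply/eqP/rowP => j; rewrite mxE; apply/eqP; rewrite -(fmorph_eq0 toK).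
  by rewrite (pmorph0_inj (has_value_pmorph (ratP j)) (V0 j)).
have -> : m.+1%:Z - 1 = m%:Z by lia.
exact: mem_code.
Qed.

Lemma prev_code_sub_code m : (prev_code C m <= C m)%VS.
Proof.
apply/subvP => v /mem_prev_code[x Lx Vx]; apply/mem_code; exists x => //.
by apply: one_point_space_le Lx; lia.
Qed.

Lemma not_prev_code m (v : 'rV[k]_n) x : v \notin prev_code C m ->
  (forall j, has_value (geom (P j)) x (toK (v 0 j))) ->
  ~ one_point_space Q (m%:Z - 1) x.
Proof. by move=> /negP np Vx Lx; apply/np/mem_prev_code; exists x. Qed.

(** Exact pole order is asked of the function [x], not of the word [u], so that the lemma applies to
    a product whose word is not yet known to have level [m]. *)
Lemma evaluation_jump m (u w : 'rV[k]_n) x y :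
  one_point_space Q m%:Z x -> ~ one_point_space Q (m%:Z - 1) x ->
  (forall j, has_value (geom (P j)) x (toK (u 0 j))) ->
  one_point_space Q m%:Z y ->
  (forall j, has_value (geom (P j)) y (toK (w 0 j))) ->
  exists c, w - c *: u \in prev_code C m.
Proof.
move=> Lx nLx Vx Ly Vy; have [a La] := one_point_space_jump ratQ Lx nLx Ly.
exists a; apply/mem_prev_code; exists (y - iota (toK a) * x) => // j.
have pV := has_value_pmorph (ratP j).
rewrite !mxE rmorphB rmorphM; apply: (pmorphB pV) => //.
by apply: (pmorphM pV) => //; apply: (pmorphC pV).
Qed.

Lemma one_point_code_jump m u w :
  u \in C m -> u \notin prev_code C m -> w \in C m ->
  exists c, w - c *: u \in prev_code C m.
Proof.
move=> /mem_code[x Lx Vx] up /mem_code[y Ly Vy].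
exact: (evaluation_jump Lx (not_prev_code up Vx) Vx Ly Vy).
Qed.

(** The product function has pole order exactly [a + b], so modulo the previous code every word of
    the code at [a + b] is a multiple of [schur u w]. Were that word in the previous code, the two
    codes would coincide. *)
Lemma one_point_code_schur a b u w :
  u \in C a -> u \notin prev_code C a -> w \in C b -> w \notin prev_code C b ->
  C (a + b)%N != prev_code C (a + b) ->
  schur u w \in C (a + b)%N /\ schur u w \notin prev_code C (a + b).
Proof.
move=> /mem_code[x Lx Vx] up /mem_code[y Ly Vy] wp jump.
have nLx := not_prev_code up Vx; have nLy := not_prev_code wp Vy.
have Vxy j : has_value (geom (P j)) (x * y) (toK (schur u w 0 j)).
  by rewrite mxE rmorphM; apply: (pmorphM (has_value_pmorph (ratP j))).
have Lxy : one_point_space Q (a + b)%N%:Z (x * y).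
  by rewrite PoszD; apply: one_point_spaceM.
have nLxy : ~ one_point_space Q ((a + b)%N%:Z - 1) (x * y).
  by rewrite PoszD; apply: one_point_spaceM_exact.
split; first by apply/mem_code; exists (x * y).
have : ~~ (C (a + b)%N <= prev_code C (a + b))%VS.
  by move: jump; rewrite eqEsubv prev_code_sub_code andbT.
move=> /subvPn[v /mem_code[f Lf Vf] vp]; apply: contra vp => sp.
have [c] := evaluation_jump Lxy nLxy Vxy Lf Vf.
by move=> /rpredD/(_ (rpredZ c sp)); rewrite subrK.
Qed.

End OnePointCodes.

Theorem theorem5p3 (k : finFieldType) (K : closedFieldType)
  (toK : {rmorphism k -> K}) (algK : integralRange toK)
  (X : curve toK) (g : nat) (hg : genus X g)
  (n : nat) (hn : (2 * g + 2 < n)%N)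
  (Q : 'I_(ambient_dim X).+1 -> k) (P : 'I_n -> 'I_(ambient_dim X).+1 -> k)
  (ratQ : rational_point X Q) (ratP : forall j, rational_point X (P j))
  (PneQ : forall j, ~ same_point (P j) Q)
  (PneP : forall j j', j <> j' -> ~ same_point (P j) (P j'))
  (m r : nat) :
  let i := \dim (code X Q P m) in
  (1 <= r <= i)%N ->
  (dstar X Q P r i <= gen_hamming_weight r (code X Q P m))%N.
Proof.
move=> i /andP[_ le_ri]; apply: gen_hamming_weight_ge => //.
- exact: prev_code_sub_code ratQ ratP.
- exact: one_point_code_jump ratQ ratP.
- exact: one_point_code_schur ratQ ratP.
Qed.
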